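(* Let $k$ be an odd integer and let $(A,\Delta_0,\Delta_1,\ldots,\Delta_i,\ldots)$ be a commutative $BV_\infty$ algebra of degree $k$. If it has the degeneration property, then the $L_\infty[1]$ algebra $(A[k+1],\Delta_0,\mathcal{K}(\Delta_1)_2,\ldots,\mathcal{K}(\Delta_{i-1})_i,\ldots)$ is homotopy abelian.
   Context: We work over a field $\mathbb{K}$ of characteristic zero; graded means $\mathbb{Z}$-graded; $V[k]^i=V^{i+k}$. Koszul brackets: for a unital graded commutative algebra $A$ and $f\in\mathrm{End}(A)$, $\mathcal{K}(f)_i:A^{\odot i}\to A$ is $\mathcal{K}(f)_0(1)=f(1)$ and $\mathcal{K}(f)_i(a_1\odot\cdots\odot a_i)=[\cdots[f,\boldsymbol{l}_{a_1}]\cdots,\boldsymbol{l}_{a_i}](1)$ for $i\ge1$, where $\boldsymbol{l}_a$ is left multiplication by $a$ and the bracket is the graded commutator. $f$ is a differential operator of order $\le j$ if $\mathcal{K}(f)_i=0$ for all $i>j$; $\mathrm{Diff}_j^d(A)$ denotes those of degree $d$. A commutative $BV_\infty$ algebra of (odd) degree $k$ consists of: (1) a commutative dg algebra $(A,\Delta_0)$ with unit $1$; (2) for every $i\ge1$ a differential operator $\Delta_i\in\mathrm{Diff}^{1-i(k+1)}_{i+1}(A)$ of degree $1-i(k+1)$ and order $\le i+1$; such that (3) $\Delta_i(1)=0$ for all $i\ge0$; and (4) if $t$ is a central variable of (even) degree $k+1$, the degree one operator $\Delta=\Delta_0+t\Delta_1+\cdots+t^i\Delta_i+\cdots$ on the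 algebra of formal power series $A[[t]]$, $\Delta(\sum_ja_jt^j)=\sum_{i,j}\Delta_i(a_j)t^{i+j}$, satisfies $\Delta^2=0$. It has the degeneration property if the projection $(A[[t]],\Delta)\to(A,\Delta_0):a(t)\mapsto a(0)$ is surjective in homology. An $L_\infty[1]$ structure on $V$ is a degree one coderivation $Q$ of $\overline{S}V=\bigoplus_{n\ge1}V^{\odot n}$ with $Q^2=0$, determined by its Taylor coefficients $q_i:V^{\odot i}\to V$. It is a fact that, for a commutative $BV_\infty$ algebra of degree $k$, $\Delta_0$ and the maps $\mathcal{K}(\Delta_{i-1})_i$, $i\ge2$, are the Taylor coefficients of an $L_\infty[1]$ structure on $A[k+1]$. $L_\infty[1]$ morphisms are morphisms of dg coalgebras; a weak equivalence is one whose linear part is a quasi-isomorphism of complexes $(V,q_1)$; an $L_\infty[1]$ algebra is abelian if $q_i=0$ for $i\ge2$, and homotopy abelian if weakly equivalent to an abelian one. *)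

(* Defs.v *)
From HB Require Import structures.
From Stdlib Require Import Relation_Operators.
From mathcomp Require Import all_boot all_order all_algebra.
From mathcomp Require Import boolp.
From mathcomp.multinomials Require Import freeg.

Set Implicit Arguments.
Unset Strict Implicit.
Unset Printing Implicit Defensive.

Import GRing.Theory.

Local Open Scope ring_scope.
Local Open Scope quotient_scope.

Inductive span (K : pzRingType) (M : lmodType K) (G : M -> Prop) : M -> Prop :=
| span_zero : span G 0
| span_step c x y : G x -> span G y -> span G (c *: x + y).

Section SpanTheory.
Variables (K : pzRingType) (M : lmodType K) (G : M -> Prop).

Lemma span_gen x : G x -> span G x.
Proof.
by move=> Gx; rewrite -[x]addr0 -[x]scale1r; apply: span_step => //; exact: span_zero.
Qed.

Lemma spanD x y : span G x -> span G y -> span G (x + y).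
Proof.
by move=> + Gy; elim=> [|c a b Ga _ IH]; rewrite ?add0r // -addrA; apply: span_step.
Qed.

Lemma spanZ c x : span G x -> span G (c *: x).
Proof.
elim=> [|d a b Ga _ IH]; first by rewrite scaler0; exact: span_zero.
by rewrite scalerDr scalerA; apply: span_step.
Qed.

Lemma spanN x : span G x -> span G (- x).
Proof. by rewrite -scaleN1r; apply: spanZ. Qed.

End SpanTheory.

Section Presented.
Variables (K : fieldType) (T : choiceType) (R : {freeg T / K} -> Prop).

Definition pres_equiv (x y : {freeg T / K}) : bool := `[< span R (x - y) >].

Lemma pres_equiv_refl : reflexive pres_equiv.
Proof. by move=> x; apply/asboolP; rewrite subrr; exact: span_zero. Qed.

Lemma pres_equiv_sym : symmetric pres_equiv.
Proof.
by move=> x y; apply/asboolP/asboolP => /spanN; rewrite opprB.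
Qed.

Lemma pres_equiv_trans : transitive pres_equiv.
Proof.
move=> y x z /asboolP xy /asboolP yz; apply/asboolP.
by rewrite -[x](subrK y) -addrA; apply: spanD.
Qed.

Canonical pres_equiv_rel :=
  EquivRel pres_equiv pres_equiv_refl pres_equiv_sym pres_equiv_trans.

Definition pres := {eq_quot pres_equiv_rel}.

HB.instance Definition _ := Choice.on pres.
HB.instance Definition _ := Quotient.on pres.
HB.instance Definition _ : EqQuotient _ pres_equiv pres := EqQuotient.on pres.

Definition pres_pi (x : {freeg T / K}) : pres := \pi_pres x.

Lemma pres_piP x y : pres_pi x = pres_pi y <-> span R (x - y).
Proof. by split=> [/eqmodP/asboolP //|xy]; apply/eqmodP/asboolP. Qed.

Lemma pres_repr u : pres_pi (repr u) = u.
Proof. exact: reprK. Qed.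

Lemma span_repr x : span R (repr (pres_pi x) - x).
Proof. by apply/pres_piP; rewrite pres_repr. Qed.

Definition pres_add (u v : pres) := pres_pi (repr u + repr v).
Definition pres_opp (u : pres) := pres_pi (- repr u).
Definition pres_scale (c : K) (u : pres) := pres_pi (c *: repr u).

Lemma pres_piD x y : pres_add (pres_pi x) (pres_pi y) = pres_pi (x + y).
Proof. by apply/pres_piP; rewrite opprD addrACA; apply: spanD; apply: span_repr. Qed.

Lemma pres_piN x : pres_opp (pres_pi x) = pres_pi (- x).
Proof. by apply/pres_piP; rewrite -opprD; apply: spanN; apply: span_repr. Qed.

Lemma pres_piZ c x : pres_scale c (pres_pi x) = pres_pi (c *: x).
Proof. by apply/pres_piP; rewrite -scalerBr; apply: spanZ; apply: span_repr. Qed.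

Fact pres_addA : associative pres_add.
Proof.
move=> u v w; rewrite -(pres_repr u) -(pres_repr v) -(pres_repr w).
by rewrite !pres_piD addrA.
Qed.

Fact pres_addC : commutative pres_add.
Proof. by move=> u v; rewrite /pres_add addrC. Qed.

Fact pres_add0 : left_id (pres_pi 0) pres_add.
Proof. by move=> u; rewrite -(pres_repr u) pres_piD add0r. Qed.

Fact pres_addN : left_inverse (pres_pi 0) pres_opp pres_add.
Proof. by move=> u; rewrite -(pres_repr u) pres_piN pres_piD addNr. Qed.

HB.instance Definition _ :=
  GRing.isZmodule.Build pres pres_addA pres_addC pres_add0 pres_addN.

Fact pres_scaleA a b u : pres_scale a (pres_scale b u) = pres_scale (a * b) u.
Proof. by rewrite -(pres_repr u) !pres_piZ scalerA. Qed.

Fact pres_scale1 : left_id 1 pres_scale.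
Proof. by move=> u; rewrite -(pres_repr u) pres_piZ scale1r. Qed.

Fact pres_scaleDr : right_distributive pres_scale +%R.
Proof.
move=> c u v; rewrite -(pres_repr u) -(pres_repr v).
by rewrite [_ + _]pres_piD !pres_piZ scalerDr [RHS]pres_piD.
Qed.

Fact pres_scaleDl u : {morph pres_scale^~ u : a b / a + b}.
Proof.
by move=> a b /=; rewrite -(pres_repr u) !pres_piZ scalerDl [RHS]pres_piD.
Qed.

HB.instance Definition _ := GRing.Zmodule_isLmodule.Build K pres
  pres_scaleA pres_scale1 pres_scaleDr pres_scaleDl.

Fact pres_pi_linear : linear pres_pi.
Proof.
by move=> c x y; rewrite -pres_piD -pres_piZ.
Qed.

HB.instance Definition _ :=
  GRing.isLinear.Build K {freeg T / K} pres _ pres_pi pres_pi_linear.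

Definition gen (x : T) : pres := pres_pi << x >>.

Lemma gen_rel x : R x -> pres_pi x = 0.
Proof. by move=> Rx; apply/pres_piP; rewrite subr0; apply: span_gen. Qed.

Lemma gen_rel_eq x y : R (x - y) -> pres_pi x = pres_pi y.
Proof. by move=> Rxy; apply/pres_piP/span_gen. Qed.

Lemma pres_ind (P : pres -> Prop) :
  P 0 -> (forall c x u, P u -> P (c *: gen x + u)) -> forall u, P u.
Proof.
move=> P0 PS u; rewrite -(pres_repr u) -[repr u]freeg_sumE linear_sum.
elim: (dom _) => [|x s IH]; rewrite ?big_nil // big_cons.
have -> : << coeff x (repr u) *g x >> = coeff x (repr u) *: (<< x >> : {freeg T / K}).
  by apply/eqP/freeg_eqP => y; rewrite coeffZ !coeffU mul1r.
by rewrite linearZ; apply: PS.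
Qed.

Section Lift.
Variables (M : lmodType K) (f : T -> M).

Fact fglift_linear : linear (fglift f : {freeg T / K} -> M).
Proof.
have fgD : {morph (fglift f : {freeg T / K} -> M) : x y / x - y}.
  exact: lift_is_additive.
have fg0 : fglift f (0 : {freeg T / K}) = 0 by rewrite -[0](subrr 0) fgD subrr.
have fgN x : fglift f (- x) = - fglift f (x : {freeg T / K}).
  by rewrite -[- x]add0r fgD fg0 add0r.
have fgA : {morph (fglift f : {freeg T / K} -> M) : x y / x + y}.
  by move=> x y; rewrite -{1}[y]opprK fgD fgN opprK.
have fgS (I : Type) (r : seq I) (F : I -> {freeg T / K}) :
    fglift f (\sum_(i <- r) F i) = \sum_(i <- r) fglift f (F i).
  by elim: r => [|i r IH]; rewrite ?big_nil ?big_cons ?fgA ?IH.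
move=> c x y; rewrite fgA; congr (_ + _).
rewrite -{1 2}[x]freeg_sumE scaler_sumr !fgS scaler_sumr.
apply: eq_bigr => z _.
have -> : c *: << coeff z x *g z >> = << c * coeff z x *g z >> :> {freeg T / K}.
  by apply/eqP/freeg_eqP => w; rewrite coeffZ !coeffU mulrA.
by rewrite !liftU scalerA.
Qed.

(* The map pres -> M that sends [gen x] to [f x], provided that the linear
   extension of f kills the relators (see pres_liftE and pres_lift_linear). *)
Definition pres_lift (u : pres) : M := fglift f (repr u).

Hypothesis fR : forall x, R x -> fglift f x = 0.

Let fg : {linear {freeg T / K} -> M} :=
  HB.pack (fglift f : {freeg T / K} -> M)
    (GRing.isLinear.Build K _ M _ (fglift f : {freeg T / K} -> M) fglift_linear).

Lemma fglift_span x : span R x -> fglift f x = 0.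
Proof.
elim=> [|c a b Ra _ IH]; first exact: (linear0 fg).
by rewrite fglift_linear IH fR // scaler0 addr0.
Qed.

Lemma pres_lift_pi x : pres_lift (pres_pi x) = fglift f x.
Proof.
have: fg (repr (pres_pi x) - x) = 0 by exact: fglift_span (span_repr x).
by rewrite linearB => /eqP; rewrite subr_eq0 => /eqP.
Qed.

Lemma pres_liftE x : pres_lift (gen x) = f x.
Proof. by rewrite pres_lift_pi liftU scale1r. Qed.

Lemma pres_lift_linear : linear pres_lift.
Proof.
move=> c u v; rewrite -(pres_repr u) -(pres_repr v) -linearP.
by rewrite !pres_lift_pi fglift_linear.
Qed.

End Lift.
End Presented.

Section Tensor.
Variable K : fieldType.

Inductive tens_rel (X Y : lmodType K) : {freeg (X * Y)%type / K} -> Prop :=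
| tens_rel_l c x x' y :
    tens_rel (<< (c *: x + x', y) >> - (c *: << (x, y) >> + << (x', y) >>))
| tens_rel_r c x y y' :
    tens_rel (<< (x, c *: y + y') >> - (c *: << (x, y) >> + << (x, y') >>)).

Definition tens (X Y : lmodType K) : lmodType K := pres (@tens_rel X Y).

Definition tensor (X Y : lmodType K) (x : X) (y : Y) : tens X Y :=
  gen (@tens_rel X Y) (x, y).

(* f tensor g, without sign; meant for linear f and g (see tmapE, tmap_linear). *)
Definition tmap (X Y X' Y' : lmodType K) (f : X -> X') (g : Y -> Y') :
    tens X Y -> tens X' Y' :=
  pres_lift (fun xy => tensor (f xy.1) (g xy.2)).

End Tensor.

(* A grading on V is given by the projections onto its components V^i. *)
Record gradedMod (K : fieldType) := GradedMod {
  gm_sort :> lmodType K;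
  gproj : int -> {linear gm_sort -> gm_sort};
  gprojE : forall i j x,
    gproj i (gproj j x) = if i == j then gproj j x else 0;
  gproj_sum : forall x, exists2 s : seq int, uniq s & x = \sum_(i <- s) gproj i x
}.

Definition homog (K : fieldType) (V : gradedMod K) (i : int) (x : V) : bool :=
  gproj V i x == x.

Section Shift.
Variables (K : fieldType) (V : gradedMod K) (k : int).

Fact shift_projE i j (x : V) :
  gproj V (i + k) (gproj V (j + k) x) = if i == j then gproj V (j + k) x else 0.
Proof. by rewrite gprojE (inj_eq (addIr k)). Qed.

Fact shift_proj_sum (x : V) :
  exists2 s : seq int, uniq s & x = \sum_(i <- s) gproj V (i + k) x.
Proof.
have [s us sx] := gproj_sum x; exists [seq i - k | i <- s].
  by rewrite map_inj_uniq //; apply: addIr.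
by rewrite big_map {1}sx; apply: eq_bigr => i _; rewrite subrK.
Qed.

(* V[k] *)
Definition shift : gradedMod K :=
  @GradedMod K V (fun i => gproj V (i + k)) shift_projE shift_proj_sum.

End Shift.

Section Sym.
Variables (K : fieldType) (V : gradedMod K).

(* The letter (i, x) stands for the component of degree i of x. *)
Definition word := seq (int * V).

Definition all_homog (w : word) : bool := all (fun a => homog a.1 (a.2 : V)) w.

Definition wdeg (w : word) : int := \sum_(a <- w) a.1.

(* Killing the empty word leaves the sum over n >= 1 of the symmetric powers. *)
Inductive sym_rel : {freeg word / K} -> Prop :=
| sym_rel_nil : sym_rel << [::] >>
| sym_rel_lin (u w : word) i c x y :
    sym_rel (<< u ++ (i, c *: x + y) :: w >>
             - (c *: << u ++ (i, x) :: w >> + << u ++ (i, y) :: w >>))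
| sym_rel_proj (u w : word) i x :
    sym_rel (<< u ++ (i, x) :: w >> - << u ++ (i, gproj V i x) :: w >>)
| sym_rel_swap (u w : word) i j x y :
    sym_rel (<< u ++ [:: (i, x), (j, y) & w] >>
             - (-1) ^ (i * j) *: << u ++ [:: (j, y), (i, x) & w] >>).

Definition Sbar : lmodType K := pres sym_rel.

Definition wd (w : word) : Sbar := gen sym_rel w.

Definition Sbar_deg (d : int) : Sbar -> Prop :=
  span (fun u => exists2 w, wdeg w = d & u = wd w).

(* All ways to deal the letters of w into two words, keeping their order, each
   with the exponent of its Koszul sign. *)
Fixpoint unshuffles (w : word) : seq (int * (word * word)) :=
  if w is a :: w' then
    [seq (t.1, (a :: t.2.1, t.2.2)) | t <- unshuffles w'] ++
    [seq (t.1 + a.1 * wdeg t.2.1, (t.2.1, a :: t.2.2)) | t <- unshuffles w']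
  else [:: (0, ([::], [::]))].

(* The reduced coproduct: the two terms with an empty factor vanish in Sbar. *)
Definition coprod_word (w : word) : tens Sbar Sbar :=
  \sum_(t <- unshuffles w) (-1) ^ t.1 *: tensor (wd t.2.1) (wd t.2.2).

Definition coprod : Sbar -> tens Sbar Sbar := pres_lift coprod_word.

Definition letter (w : word) : V := if w is [:: a] then gproj V a.1 a.2 else 0.

Definition corestr : Sbar -> V := pres_lift letter.

Definition parity : Sbar -> Sbar := pres_lift (fun w => (-1) ^ wdeg w *: wd w).

End Sym.

Section TensorTheory.
Variables (K : fieldType).

Lemma tensorPl (X Y : lmodType K) (y : Y) : linear (fun x : X => tensor x y).
Proof.
move=> c x x'; rewrite /tensor /gen -linearP.
exact: gen_rel_eq (tens_rel_l c x x' y).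
Qed.

Lemma tensorPr (X Y : lmodType K) (x : X) : linear (fun y : Y => tensor x y).
Proof.
move=> c y y'; rewrite /tensor /gen -linearP.
exact: gen_rel_eq (tens_rel_r c x y y').
Qed.

Variables (X Y X' Y' : lmodType K).
Variables (f : {linear X -> X'}) (g : {linear Y -> Y'}).

Fact tmap_rel r : tens_rel r ->
  fglift (fun xy : X * Y => tensor (f xy.1) (g xy.2)) r = 0.
Proof.
have flin := fglift_linear (fun xy : X * Y => tensor (f xy.1) (g xy.2)).
have flE z : fglift (fun xy : X * Y => tensor (f xy.1) (g xy.2)) << z >> =
    tensor (f z.1) (g z.2) by rewrite liftU scale1r.
case=> [c x x' y|c x y y']; rewrite lift_is_additive flin !flE /= linearP.
  by rewrite tensorPl subrr.
by rewrite tensorPr subrr.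
Qed.

Lemma tmapE x y : tmap f g (tensor x y) = tensor (f x) (g y).
Proof. exact: (pres_liftE tmap_rel (x, y)). Qed.

Lemma tmap_linear : linear (tmap f g).
Proof. exact: pres_lift_linear tmap_rel. Qed.

HB.instance Definition _ :=
  GRing.isLinear.Build K (tens X Y) (tens X' Y') _ (tmap f g) tmap_linear.

End TensorTheory.

Section SymTheory.
Variables (K : fieldType) (V : gradedMod K).

Implicit Types (u w p q : word V).

Lemma wd_nil : wd [::] = 0 :> Sbar V.
Proof. exact: gen_rel (sym_rel_nil V). Qed.

Lemma wd_lin u w i c x y :
  wd (u ++ (i, c *: x + y) :: w) =
  c *: wd (u ++ (i, x) :: w) + wd (u ++ (i, y) :: w) :> Sbar V.
Proof.
rewrite /wd /gen -linearP; exact: gen_rel_eq (sym_rel_lin u w i c x y).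
Qed.

Lemma wd_proj u w i x :
  wd (u ++ (i, x) :: w) = wd (u ++ (i, gproj V i x) :: w) :> Sbar V.
Proof.
exact: gen_rel_eq (sym_rel_proj u w i x).
Qed.

Lemma wd_swap u w i j x y :
  wd (u ++ [:: (i, x), (j, y) & w]) =
  (-1) ^ (i * j) *: wd (u ++ [:: (j, y), (i, x) & w]) :> Sbar V.
Proof.
rewrite /wd /gen -linearZ; exact: gen_rel_eq (sym_rel_swap u w i j x y).
Qed.

Lemma ksignD (a b : int) : (-1) ^ (a + b) = (-1) ^ a * (-1) ^ b :> K.
Proof. by rewrite expfzDr // oppr_eq0 oner_eq0. Qed.

Lemma ksignK (a : int) : (-1) ^ a * (-1) ^ a = 1 :> K.
Proof. by rewrite -expfzMl mulrNN mulr1 exp1rz. Qed.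

Lemma wdeg_nil : wdeg ([::] : word V) = 0.
Proof. by rewrite /wdeg big_nil. Qed.

Lemma wdeg_cons (a : int * V) w : wdeg (a :: w) = a.1 + wdeg w.
Proof. by rewrite /wdeg big_cons. Qed.

Lemma wdeg_cat u w : wdeg (u ++ w) = wdeg u + wdeg w.
Proof. by rewrite /wdeg big_cat. Qed.

Definition sym_compat (M : lmodType K) (f : word V -> M) : Prop :=
  [/\ f [::] = 0,
      forall u w i c x y, f (u ++ (i, c *: x + y) :: w) =
        c *: f (u ++ (i, x) :: w) + f (u ++ (i, y) :: w),
      forall u w i x, f (u ++ (i, x) :: w) = f (u ++ (i, gproj V i x) :: w)
    & forall u w i j x y, f (u ++ [:: (i, x), (j, y) & w]) =
        (-1) ^ (i * j) *: f (u ++ [:: (j, y), (i, x) & w])].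

Lemma sym_compatP (M : lmodType K) (f : word V -> M) :
  sym_compat f -> forall r, sym_rel r -> fglift f r = 0.
Proof.
move=> [f0 fl fp fs] r.
have flin := fglift_linear f.
have flE z : fglift f << z >> = f z by rewrite liftU scale1r.
have fl0 : fglift f (0 : {freeg (word V) / K}) = 0.
  by rewrite -[0](subrr 0) lift_is_additive subrr.
case=> [|u w i c x y|u w i x|u w i j x y].
- by rewrite flE.
- by rewrite lift_is_additive flin !flE fl subrr.
- by rewrite lift_is_additive !flE fp subrr.
rewrite lift_is_additive -[_ ^ _ *: _]addr0 flin fl0 !flE fs addr0.
by rewrite subrr.
Qed.

Section SymLift.
Variables (M : lmodType K) (f : word V -> M).
Hypothesis fV : sym_compat f.

Lemma sym_liftE w : pres_lift f (wd w) = f w.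
Proof. exact: (pres_liftE (sym_compatP fV) w). Qed.

Lemma sym_lift_linear : linear (pres_lift f : Sbar V -> M).
Proof. exact: pres_lift_linear (sym_compatP fV). Qed.

End SymLift.

Fact letter_compat : sym_compat (@letter K V).
Proof.
split=> //= [u w i c x y|u w i x|u w i j x y].
- case: u w => [|a [|b u]] [|e w] //=; rewrite ?scaler0 ?addr0 //.
  by rewrite linearP.
- case: u w => [|a [|b u]] [|e w] //=.
  by rewrite gprojE eqxx.
- by case: u => [|a [|b u]]; rewrite /= scaler0.
Qed.

Lemma corestr_wd w : corestr (wd w) = letter w.
Proof. exact: sym_liftE letter_compat w. Qed.

Lemma corestr_linear : linear (@corestr K V).
Proof. exact: sym_lift_linear letter_compat. Qed.

HB.instance Definition _ :=
  GRing.isLinear.Build K (Sbar V) V _ (@corestr K V) corestr_linear.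

Fact parity_compat : sym_compat (fun w : word V => (-1) ^ wdeg w *: wd w).
Proof.
split=> [|u w i c x y|u w i x|u w i j x y].
- by rewrite wd_nil scaler0.
- rewrite !wdeg_cat !wdeg_cons wd_lin scalerDr !scalerA.
  by rewrite [c * _]mulrC.
- by rewrite !wdeg_cat !wdeg_cons wd_proj.
rewrite !wdeg_cat !wdeg_cons wd_swap !scalerA /=; congr (_ *: _).
by rewrite [RHS]mulrC [j + (i + _)]addrCA.
Qed.

Lemma parity_wd w : parity (wd w) = (-1) ^ wdeg w *: wd w.
Proof. exact: sym_liftE parity_compat w. Qed.

Lemma parity_linear : linear (@parity K V).
Proof. exact: sym_lift_linear parity_compat. Qed.

HB.instance Definition _ :=
  GRing.isLinear.Build K (Sbar V) (Sbar V) _ (@parity K V) parity_linear.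

(* The part of the coproduct of a word p ++ q ++ w where the letters of p go
   left and those of q, of total degree m, go right. *)
Let C (m : int) (p q w : word V) : tens (Sbar V) (Sbar V) :=
  \sum_(t <- unshuffles w)
     (-1) ^ (t.1 + m * wdeg t.2.1) *: tensor (wd (p ++ t.2.1)) (wd (q ++ t.2.2)).

Let C_cons m p q a w :
  C m p q (a :: w) = (-1) ^ (m * a.1) *: C m (rcons p a) q w
                     + C (m + a.1) p (rcons q a) w.
Proof.
rewrite /C /= big_cat !big_map scaler_sumr; congr (_ + _);
  apply: eq_bigr => -[e [l r]] _ /=; rewrite cat_rcons.
  by rewrite scalerA -ksignD wdeg_cons mulrDr addrCA.
by rewrite mulrDl addrAC addrA addrAC.
Qed.

Let C_p_lin m p p' q w i c x y :
  C m (p ++ (i, c *: x + y) :: p') q w =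
  c *: C m (p ++ (i, x) :: p') q w + C m (p ++ (i, y) :: p') q w.
Proof.
rewrite /C scaler_sumr -big_split; apply: eq_bigr => -[e [l r]] _ /=.
by rewrite -!catA !cat_cons wd_lin tensorPl scalerDr !scalerA mulrC.
Qed.

Let C_q_lin m p q q' w i c x y :
  C m p (q ++ (i, c *: x + y) :: q') w =
  c *: C m p (q ++ (i, x) :: q') w + C m p (q ++ (i, y) :: q') w.
Proof.
rewrite /C scaler_sumr -big_split; apply: eq_bigr => -[e [l r]] _ /=.
by rewrite -!catA !cat_cons wd_lin tensorPr scalerDr !scalerA mulrC.
Qed.

Let C_p_proj m p p' q w i x :
  C m (p ++ (i, x) :: p') q w = C m (p ++ (i, gproj V i x) :: p') q w.
Proof.
by apply: eq_bigr => -[e [l r]] _ /=; rewrite -!catA !cat_cons wd_proj.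
Qed.

Let C_q_proj m p q q' w i x :
  C m p (q ++ (i, x) :: q') w = C m p (q ++ (i, gproj V i x) :: q') w.
Proof.
apply: eq_bigr => -[e [l r]] _ /=; rewrite -!catA !cat_cons.
by rewrite [wd (q ++ _)]wd_proj.
Qed.

Let tensorZl c (a b : Sbar V) : tensor (c *: a) b = c *: tensor a b.
Proof.
have t0 : tensor 0 b = 0 :> tens (Sbar V) (Sbar V).
  have := tensorPl b 1 (0 : Sbar V) 0; rewrite scale1r addr0 scale1r => /eqP.
  by rewrite -subr_eq0 opprD addNKr oppr_eq0 => /eqP.
by rewrite -[c *: a]addr0 tensorPl t0 addr0.
Qed.

Let tensorZr c (a b : Sbar V) : tensor a (c *: b) = c *: tensor a b.
Proof.
have t0 : tensor a 0 = 0 :> tens (Sbar V) (Sbar V).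
  have := tensorPr a 1 (0 : Sbar V) 0; rewrite scale1r addr0 scale1r => /eqP.
  by rewrite -subr_eq0 opprD addNKr oppr_eq0 => /eqP.
by rewrite -[c *: b]addr0 tensorPr t0 addr0.
Qed.

Let C_p_swap m p q w i j x y :
  C m (p ++ [:: (i, x); (j, y)]) q w =
  (-1) ^ (i * j) *: C m (p ++ [:: (j, y); (i, x)]) q w.
Proof.
rewrite /C scaler_sumr; apply: eq_bigr => -[e [l r]] _ /=.
by rewrite -!catA !cat_cons wd_swap tensorZl !scalerA mulrC.
Qed.

Let C_q_swap m p q w i j x y :
  C m p (q ++ [:: (i, x); (j, y)]) w =
  (-1) ^ (i * j) *: C m p (q ++ [:: (j, y); (i, x)]) w.
Proof.
rewrite /C scaler_sumr; apply: eq_bigr => -[e [l r]] _ /=.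
by rewrite -!catA !cat_cons wd_swap tensorZr !scalerA mulrC.
Qed.

Let C0 w : C 0 [::] [::] w = coprod_word w.
Proof. by apply: eq_bigr => t _ /=; rewrite mul0r addr0. Qed.

Let C_lin m p q u w i c x y :
  C m p q (u ++ (i, c *: x + y) :: w) =
  c *: C m p q (u ++ (i, x) :: w) + C m p q (u ++ (i, y) :: w).
Proof.
elim: u m p q => [|a u IH] m p q /=; rewrite !C_cons /=.
  rewrite -!cats1 C_p_lin C_q_lin !scalerDr !scalerA [c * _]mulrC.
  by rewrite addrACA.
by rewrite !IH !scalerDr !scalerA [c * _]mulrC addrACA.
Qed.

Let C_proj m p q u w i x :
  C m p q (u ++ (i, x) :: w) = C m p q (u ++ (i, gproj V i x) :: w).
Proof.
elim: u m p q => [|a u IH] m p q /=; rewrite !C_cons /=; last by rewrite !IH.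
by rewrite -!cats1 C_p_proj C_q_proj.
Qed.

Let C_swap m p q u w i j x y :
  C m p q (u ++ [:: (i, x), (j, y) & w]) =
  (-1) ^ (i * j) *: C m p q (u ++ [:: (j, y), (i, x) & w]).
Proof.
elim: u m p q => [|a u IH] m p q /=; last first.
  by rewrite !C_cons !IH scalerDr !scalerA [_ ^ (i * j) * _]mulrC.
rewrite !C_cons /= -!cats1 -!catA /= C_p_swap C_q_swap.
rewrite !scalerDr !scalerA [RHS]addrACA [m + j + i]addrAC.
rewrite !mulrDl !ksignD [j * i]mulrC.
have sK z : (-1) ^ (i * j) * (z * (-1) ^ (i * j)) = z :> K.
  by rewrite mulrCA ksignK mulr1.
rewrite sK; congr (_ *: _ + _ + (_ *: _ + _)); last by rewrite mulrC.
by rewrite mulrC [(-1) ^ (m * i) * _]mulrC mulrA.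
Qed.

Fact coprod_compat : sym_compat (@coprod_word K V).
Proof.
split=> [|u w i c x y|u w i x|u w i j x y]; rewrite -!C0.
- rewrite /C /= big_seq1 /= wd_nil -[X in tensor X _](scale0r 0).
  by rewrite tensorZl scale0r scaler0.
- exact: C_lin.
- exact: C_proj.
exact: C_swap.
Qed.

Lemma coprod_wd w : coprod (wd w) = coprod_word w.
Proof. exact: sym_liftE coprod_compat w. Qed.

Lemma coprod_linear : linear (@coprod K V).
Proof. exact: sym_lift_linear coprod_compat. Qed.

HB.instance Definition _ :=
  GRing.isLinear.Build K (Sbar V) (tens (Sbar V) (Sbar V)) _
    (@coprod K V) coprod_linear.

End SymTheory.

Section Linfty.
Variable K : fieldType.

Record Linfty (V : gradedMod K) := MkLinfty {
  Lcod :> {linear Sbar V -> Sbar V};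
  Lcod_deg : forall d u, Sbar_deg d u -> Sbar_deg (d + 1) (Lcod u);
  (* by the Koszul rule, (id tensor Q)(x tensor y) = (-1)^|x| x tensor Q y *)
  Lcod_coder : forall u,
    coprod (Lcod u) = tmap Lcod id (coprod u) + tmap (@parity K V) Lcod (coprod u);
  Lcod_sq : forall u, Lcod (Lcod u) = 0
}.

(* The Taylor coefficient q_n evaluated at a word of length n *)
Definition taylor (V : gradedMod K) (Q : Linfty V) (w : word V) : V :=
  corestr (Q (wd w)).

Definition abelian (V : gradedMod K) (Q : Linfty V) : Prop :=
  forall w : word V, (1 < size w)%N -> taylor Q w = 0.

Record Linfty_morph (V W : gradedMod K) (Q : Linfty V) (R : Linfty W) := MkMorph {
  Lmor :> {linear Sbar V -> Sbar W};
  Lmor_deg : forall d u, Sbar_deg d u -> Sbar_deg d (Lmor u);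
  Lmor_coprod : forall u, coprod (Lmor u) = tmap Lmor Lmor (coprod u);
  Lmor_cod : forall u, Lmor (Q u) = R (Lmor u)
}.

(* The tangent complex (V, q_1), on elements x of degree i *)
Definition Ldiff (V : gradedMod K) (Q : Linfty V) (i : int) (x : V) : V :=
  taylor Q [:: (i, x)].

Definition linear_part (V W : gradedMod K) (Q : Linfty V) (R : Linfty W)
    (F : Linfty_morph Q R) (i : int) (x : V) : W :=
  corestr (F (wd [:: (i, x)])).

(* The linear part is bijective in homology. *)
Definition weak_equivalence (V W : gradedMod K) (Q : Linfty V) (R : Linfty W)
    (F : Linfty_morph Q R) : Prop :=
  (forall i (x : V) (z : W), homog i x -> Ldiff Q i x = 0 -> homog (i - 1) z ->
     linear_part F i x = Ldiff R (i - 1) z ->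
     exists2 v : V, homog (i - 1) v & x = Ldiff Q (i - 1) v) /\
  (forall i (y : W), homog i y -> Ldiff R i y = 0 ->
     exists (x : V) (z : W), [/\ homog i x, Ldiff Q i x = 0, homog (i - 1) z
       & y = linear_part F i x + Ldiff R (i - 1) z]).

Record LinftyAlg := MkLinftyAlg {
  la_mod : gradedMod K;
  la_str :> Linfty la_mod
}.

Definition has_weak_equivalence (L M : LinftyAlg) : Prop :=
  exists F : Linfty_morph L M, weak_equivalence F.

Definition weakly_equivalent : LinftyAlg -> LinftyAlg -> Prop :=
  clos_refl_sym_trans LinftyAlg has_weak_equivalence.

Definition homotopy_abelian (L : LinftyAlg) : Prop :=
  exists2 M : LinftyAlg, abelian M & weakly_equivalent L M.

End Linfty.

(* Not built on algType, which would exclude the zero algebra *)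
Record gradedComAlg (K : fieldType) := GradedComAlg {
  ga_mod :> gradedMod K;
  gone : ga_mod;
  gmul : ga_mod -> ga_mod -> ga_mod;
  gmul_linl : forall b, linear (gmul^~ b);
  gmul_linr : forall a, linear (gmul a);
  gmulA : associative gmul;
  gmul1 : left_id gone gmul;
  gone_deg : homog 0 gone;
  gmul_deg : forall i j a b, homog i a -> homog j b -> homog (i + j) (gmul a b);
  gmulC : forall i j a b, homog i a -> homog j b ->
    gmul a b = (-1) ^ (i * j) *: gmul b a
}.

Section BV.
Variables (K : fieldType) (A : gradedComAlg K).

(* K(f)_n(a_1, ..., a_n) for f of degree d and s = [:: (|a_1|, a_1); ...; (|a_n|, a_n)];
   each step replaces f by the graded commutator of f and l_a. *)
Fixpoint koszul (d : int) (f : A -> A) (s : seq (int * A)) : A :=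
  if s is (i, a) :: s' then
    koszul (d + i) (fun x => f (gmul a x) - (-1) ^ (d * i) *: gmul a (f x)) s'
  else f (gone A).

Definition has_degree (d : int) (f : A -> A) : Prop :=
  forall i x, homog i x -> homog (i + d) (f x).

Definition diff_op (j : nat) (d : int) (f : A -> A) : Prop :=
  has_degree d f /\
  forall s : word A, all_homog s -> (j < size s)%N -> koszul d f s = 0.

(* sum_i t^i Delta_i acting on a formal power series sum_j a_j t^j *)
Definition fps_op (Delta : nat -> A -> A) (a : nat -> A) (n : nat) : A :=
  \sum_(i < n.+1) Delta i (a (n - i)%N).

Definition bv_deg (k : int) (i : nat) : int := 1 - i%:Z * (k + 1).

Record commBVinfty (k : int) (Delta : nat -> {linear A -> A}) : Prop := {
  bv_deg0 : has_degree 1 (Delta 0);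
  bv_sq0 : forall x, Delta 0 (Delta 0 x) = 0;
  bv_leibniz : forall i a b, homog i a ->
    Delta 0 (gmul a b) = gmul (Delta 0 a) b + (-1) ^ i *: gmul a (Delta 0 b);
  bv_diff : forall i, (0 < i)%N -> diff_op i.+1 (bv_deg k i) (Delta i);
  bv_one : forall i, Delta i (gone A) = 0;
  bv_sq : forall a n, fps_op Delta (fps_op Delta a) n = 0
}.

(* The series of degree d in A[[t]], where t has degree k + 1 *)
Definition fps_homog (k d : int) (a : nat -> A) : Prop :=
  forall j, homog (d - j%:Z * (k + 1)) (a j).

Definition degeneration (k : int) (Delta : nat -> A -> A) : Prop :=
  forall d x, homog d x -> Delta 0 x = 0 ->
  exists (a : nat -> A) (z : A),
    [/\ fps_homog k d a, forall n, fps_op Delta a n = 0,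
        homog (d - 1) z & x = a 0%N + Delta 0 z].

(* The n-th Taylor coefficient on A[k+1]: a letter of degree i in A[k+1] has
   degree i + (k + 1) in A. *)
Definition bv_taylor (k : int) (Delta : nat -> A -> A)
    (w : word (shift A (k + 1))) : A :=
  match w with
  | [::] => 0
  | [:: a] => Delta 0 a.2
  | _ => koszul (bv_deg k (size w).-1) (Delta (size w).-1)
           [seq (a.1 + (k + 1), a.2 : A) | a <- w]
  end.

(* Q is the L_oo[1] structure on A[k+1] with Taylor coefficients
   Delta_0, K(Delta_1)_2, K(Delta_2)_3, ... *)
Definition is_bv_Linfty (k : int) (Delta : nat -> A -> A)
    (Q : Linfty (shift A (k + 1))) : Prop :=
  forall w : word (shift A (k + 1)), all_homog w -> taylor Q w = bv_taylor Delta w.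

End BV.

(* Main.v *)
Require Import Defs.
From HB Require Import structures.
From Stdlib Require Import Permutation List Relation_Operators.
From mathcomp Require Import all_boot all_order all_algebra.
From mathcomp Require Import boolp classical_sets functions.
From mathcomp.multinomials Require Import freeg.

Set Implicit Arguments.
Unset Strict Implicit.
Unset Printing Implicit Defensive.

Import GRing.Theory.
Local Open Scope ring_scope.

(** Write D = Delta_0 + t Delta_1 + ... on A[[t]].  As Delta_i has order at most
    i + 1, the n-th Koszul bracket of D is divisible by t^(n-1), and its
    coefficient at t^(n-1) is the bracket K(Delta_(n-1))_n, the n-th Taylor
    coefficient on A[k+1].  Koszul brackets and products are linked by the
    identity (apply_sprod)

       D (x_1 ... x_n) = sum over unshuffles (l, r) of +- K(D)(x_l) x_r .

    Let H be a graded space of representatives of the homology of Delta_0, viewed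
    as an L_oo[1] algebra with zero structure, and let f assign to each word w in H
    a series f(w) in A[[t]], graded symmetric and multilinear in the letters.  Two
    sums over the set partitions of w are formed with the weights
    g(B) = t^(|B|-1) f(B): the exponential e(w) of the products of the g(B) (expS)
    and the sum phi(w) of the brackets K(D)(g(B_1), ..., g(B_j)) (brackS).  Sums
    over partitions turn unshuffles into unshuffles (part_sum_unsh), so that
    (fps_op_exp)

       D e(w) = sum over unshuffles (l, r) of w of +- phi(l) e(r) .

    Moreover phi(w) is divisible by t^(|w|-1), and its coefficient there
    (brackS_lead) is the corestriction of Q F (w), where F is the coalgebra
    morphism whose Taylor coefficients are the constant terms of f.  Once phi
    vanishes, so does the corestriction of Q F; in characteristic zero a
    coderivation along a morphism is determined by its corestriction
    (coder_along_zero), hence Q F = 0 and F is an L_oo[1] morphism from H.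

    It remains to find f with D e = 0 on nonempty words, which gives phi = 0 by
    induction on the length.  On letters f lifts a class to a D-closed series,
    which is what the degeneration property provides.  For a word w of length
    m + 1 > 1, the part of e(w) that comes from shorter blocks has an image under
    D divisible by t^m, namely the corresponding part of phi(w).  The degeneration
    property says that the homology of A[[t]] has no t-torsion (torsion_free), so
    this image is D (t^m c) for some series c, and f(w) = - c is the right choice.
    Multilinearity of f asks for a linear choice of c, obtained from Zorn's lemma
    (linear_selection), as is the space H.  The linear part of F is the inclusion
    of H, so F is a weak equivalence from an abelian algebra. *)

(** * Koszul signs, unshuffles and set partitions *)

Section Signed.
Variable N : zmodType.
Implicit Types x y : N.

(** A Koszul sign is carried by the parity of its exponent, so that an identity
    between signs can be proved by cases on Booleans. *)
Definition signed (b : bool) x : N := if b then - x else x.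

Lemma signedD b x y : signed b (x + y) = signed b x + signed b y.
Proof. by case: b => //; rewrite /signed opprD. Qed.

Lemma signed0 b : signed b 0 = 0 :> N.
Proof. by case: b => //; rewrite /signed oppr0. Qed.

Lemma signedA b c x : signed b (signed c x) = signed (b (+) c) x.
Proof. by case: b; case: c; rewrite /signed ?opprK. Qed.

End Signed.

Lemma raddf_signed (M N : zmodType) (f : {additive M -> N}) b x :
  f (signed b x) = signed b (f x).
Proof. by case: b; rewrite /signed ?raddfN. Qed.

Lemma signedZ (K : pzRingType) (M : lmodType K) b c (x : M) :
  signed b (c *: x) = c *: signed b x.
Proof. by case: b; rewrite /signed ?scalerN. Qed.

Section Words.
Variables (T : Type) (p : T -> bool).

Fixpoint wpar (w : seq T) : bool := if w is a :: w' then p a (+) wpar w' else false.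

Lemma wpar_cat u w : wpar (u ++ w) = wpar u (+) wpar w.
Proof. by elim: u => //= a u ->; rewrite addbA. Qed.

Lemma wpar_perm u w : Permutation u w -> wpar u = wpar w.
Proof.
elim=> //= [a x y _ -> //|a b x|x y z _ -> _ ->//].
by rewrite addbCA.
Qed.

(** The sum of the values of Z at the unshuffles of w, with their Koszul signs;
    moving a to the right of the left factor l costs the sign of a against l.
    Recursion on the function Z keeps the signs out of any list of terms. *)
Fixpoint unsh_sum (N : zmodType) (w : seq T) (Z : seq T -> seq T -> N) : N :=
  if w is a :: w' then
    unsh_sum w' (fun l r => Z (a :: l) r) +
    unsh_sum w' (fun l r => signed (p a && wpar l) (Z l (a :: r)))
  else Z [::] [::].

Section UnshTheory.
Variable N : zmodType.
Implicit Types Z : seq T -> seq T -> N.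

Lemma unsh_sum_ext w Z Z' :
  (forall l r, Permutation (l ++ r) w -> Z l r = Z' l r) ->
  unsh_sum w Z = unsh_sum w Z'.
Proof.
elim: w Z Z' => [|a w IH] Z Z' ZZ /=; first exact: ZZ.
congr (_ + _); apply: IH => l r lr.
  by apply: ZZ => /=; constructor.
congr (signed _ _); apply: ZZ; apply: Permutation_sym.
by apply: Permutation_cons_app; apply: Permutation_sym.
Qed.

Lemma unsh_sumD w Z Z' :
  unsh_sum w (fun l r => Z l r + Z' l r) = unsh_sum w Z + unsh_sum w Z'.
Proof.
elim: w Z Z' => [|a w IH] Z Z' //=.
rewrite addrACA IH; congr (_ + _); rewrite -IH.
by apply: unsh_sum_ext => l r _; rewrite signedD.
Qed.

Lemma unsh_sum0 w : unsh_sum w (fun _ _ => 0 : N) = 0.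
Proof.
elim: w => [|a w IH] //=; rewrite IH add0r -[RHS]IH.
by apply: unsh_sum_ext => l r _; rewrite signed0.
Qed.

(** Only (w, nil) has a left factor that is not shorter than w. *)
Lemma unsh_sum_top w Z :
  (forall l r, (size l < size w)%N -> Z l r = 0) -> unsh_sum w Z = Z w [::].
Proof.
elim: w Z => [|a w IH] Z Z0 //=.
rewrite IH => [|l r lw]; last exact: Z0.
rewrite -[RHS]addr0; congr (_ + _); rewrite -[RHS](unsh_sum0 w).
apply: unsh_sum_ext => l r /Permutation_length lr.
have {}lr : size (l ++ r) = size w := lr.
by rewrite Z0 ?signed0 //= ltnS -lr size_cat leq_addr.
Qed.

Lemma unsh_sum_nil w (h : seq T -> N) :
  unsh_sum w (fun l r => if l is [::] then h r else 0) = h w.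
Proof.
elim: w h => [|a w IH] h //=; rewrite unsh_sum0 add0r -[RHS](IH (fun r => h (a :: r))).
by apply: unsh_sum_ext => -[|b l] r _; rewrite ?andbF // signed0.
Qed.

End UnshTheory.

Lemma raddf_unsh_sum (M N : zmodType) (f : {additive M -> N}) w Z :
  f (unsh_sum w Z) = unsh_sum w (fun l r => f (Z l r)).
Proof.
elim: w Z => [|a w IH] Z //=; rewrite raddfD !IH.
by congr (_ + unsh_sum _ _); apply: funext => l; apply: funext => r; rewrite raddf_signed.
Qed.

Lemma unsh_sum_signed (N : zmodType) b w (Z : seq T -> seq T -> N) :
  signed b (unsh_sum w Z) = unsh_sum w (fun l r => signed b (Z l r)).
Proof.
elim: w Z => [|a w IH] Z //=; rewrite signedD !IH; congr (_ + unsh_sum _ _).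
by apply: funext => l; apply: funext => r; rewrite !signedA addbC.
Qed.

Lemma unsh_sumZ (K : pzRingType) (N : lmodType K) (c : K) w (Z : seq T -> seq T -> N) :
  unsh_sum w (fun l r => c *: Z l r) = c *: unsh_sum w Z.
Proof.
elim: w Z => [|a w IH] Z //=; rewrite scalerDr -!IH; congr (_ + unsh_sum _ _).
by apply: funext => l; apply: funext => r; rewrite signedZ.
Qed.

End Words.

Lemma wpar_map (T U : Type) (q : U -> bool) (h : T -> U) w :
  wpar q (map h w) = wpar (q \o h) w.
Proof. by elim: w => //= a w ->. Qed.

Lemma unsh_sum_map (T U : Type) (q : U -> bool) (h : T -> U) (N : zmodType) w
    (Z : seq U -> seq U -> N) :
  unsh_sum q (map h w) Z = unsh_sum (q \o h) w (fun l r => Z (map h l) (map h r)).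
Proof.
elim: w Z => [|a w IH] Z //=; rewrite !IH /=; congr (_ + unsh_sum _ _ _).
by apply: funext => l; apply: funext => r; rewrite wpar_map.
Qed.

Section PartSum.
Variables (T : Type) (p : T -> bool).
Implicit Types (w B C : seq T) (P Q L R : seq (seq T)).

(** The recursion absorbs into Th the blocks that a has passed; each of them costs
    the sign of a against it. *)
Fixpoint insert_sum (N : zmodType) (a : T) (Th : seq (seq T) -> N) P : N :=
  if P is B :: P' then
    Th ((a :: B) :: P') + signed (p a && wpar p B) (insert_sum a (fun Q => Th (B :: Q)) P')
  else 0.

Definition extend_sum (N : zmodType) a (Th : seq (seq T) -> N) P : N :=
  Th ([:: a] :: P) + insert_sum a Th P.

(** The sum of Th over the set partitions of w, with Koszul signs.  Each new
    letter either opens a block in front or joins an existing block, so every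
    partition appears once, its blocks being ordered by their last letters. *)
Fixpoint part_sum (N : zmodType) w (Th : seq (seq T) -> N) : N :=
  if w is a :: w' then part_sum w' (extend_sum a Th) else Th [::].

Section PartSumTheory.
Variable N : zmodType.
Implicit Types Th : seq (seq T) -> N.

Lemma insert_sum_ext a Th Th' P :
  (forall Q, Permutation (flatten Q) (a :: flatten P) ->
     (all (fun B => (0 < size B)%N) P -> all (fun B => (0 < size B)%N) Q) ->
     Th Q = Th' Q) ->
  insert_sum a Th P = insert_sum a Th' P.
Proof.
elim: P Th Th' => [|B P IH] Th Th' TT //=; congr (_ + signed _ _).
  by apply: TT => //= /andP[].
apply: IH => Q pQ nQ; apply: TT => /=.
  rewrite -cat_cons; apply: Permutation_trans (Permutation_app_head B pQ) _.
  by apply: Permutation_sym; exact: Permutation_middle.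
by case/andP => -> /nQ.
Qed.

(** Only actual partitions of w matter, which gives access to the lengths and the
    degrees of the blocks wherever a summand is rewritten. *)
Lemma part_sum_ext w Th Th' :
  (forall P, Permutation (flatten P) w ->
     all (fun B => (0 < size B)%N) P -> Th P = Th' P) ->
  part_sum w Th = part_sum w Th'.
Proof.
elim: w Th Th' => [|a w IH] Th Th' TT /=; first exact: TT.
apply: IH => P pP nP; rewrite /extend_sum; congr (_ + _).
  by apply: TT => //=; constructor.
apply: insert_sum_ext => Q pQ nQ; apply: TT; last exact: nQ.
by apply: Permutation_trans pQ _; constructor.
Qed.

Lemma insert_sumD a Th Th' P :
  insert_sum a (fun Q => Th Q + Th' Q) P = insert_sum a Th P + insert_sum a Th' P.
Proof.
by elim: P Th Th' => [|B P IH] Th Th' /=; rewrite ?addr0 // IH signedD addrACA.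
Qed.

Lemma insert_sum_signed a b Th P :
  insert_sum a (fun Q => signed b (Th Q)) P = signed b (insert_sum a Th P).
Proof.
elim: P Th => [|B P IH] Th /=; first by rewrite signed0.
by rewrite IH signedD !signedA addbC.
Qed.

Lemma extend_sumD a Th Th' :
  extend_sum a (fun Q => Th Q + Th' Q) = fun P => extend_sum a Th P + extend_sum a Th' P.
Proof. by apply: funext => P; rewrite /extend_sum insert_sumD addrACA. Qed.

Lemma extend_sum_signed a b Th :
  extend_sum a (fun Q => signed b (Th Q)) = fun P => signed b (extend_sum a Th P).
Proof. by apply: funext => P; rewrite /extend_sum insert_sum_signed signedD. Qed.

Lemma part_sumD w Th Th' :
  part_sum w (fun Q => Th Q + Th' Q) = part_sum w Th + part_sum w Th'.
Proof. by elim: w Th Th' => [|a w IH] Th Th' //=; rewrite extend_sumD IH. Qed.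

Lemma part_sum1 a Th : part_sum [:: a] Th = Th [:: [:: a]].
Proof. exact: addr0. Qed.

Lemma part_sum_signed w b Th :
  part_sum w (fun Q => signed b (Th Q)) = signed b (part_sum w Th).
Proof. by elim: w Th => [|a w IH] Th //=; rewrite extend_sum_signed IH. Qed.

Lemma part_sum0 w Th : (forall P, Permutation (flatten P) w ->
  all (fun B => (0 < size B)%N) P -> Th P = 0) -> part_sum w Th = 0.
Proof.
move=> Th0; rewrite (part_sum_ext (Th' := fun=> 0)) // => {Th0 Th}.
elim: w => //= a w IH; rewrite -[RHS]IH; congr (part_sum _ _).
by apply: funext => P; rewrite /extend_sum add0r; elim: P => //= B P ->; rewrite signed0 addr0.
Qed.

Lemma part_sum_closed (Pr : N -> Prop) w Th :
  Pr 0 -> (forall x y, Pr x -> Pr y -> Pr (x + y)) -> (forall x, Pr x -> Pr (- x)) ->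
  (forall P, Permutation (flatten P) w ->
     all (fun B => (0 < size B)%N) P -> Pr (Th P)) ->
  Pr (part_sum w Th).
Proof.
move=> Pr0 PrD PrN; have PrS b x : Pr x -> Pr (signed b x) by case: b => //; apply: PrN.
have insP a P : forall Th, (forall Q, Permutation (flatten Q) (a :: flatten P) ->
    (all (fun B => (0 < size B)%N) P -> all (fun B => (0 < size B)%N) Q) ->
    Pr (Th Q)) -> Pr (insert_sum a Th P).
  elim: P => [|B P IH] Th' hT //=; apply: PrD; first by apply: hT => //= /andP[].
  apply/PrS/IH => Q pQ nQ; apply: hT => /=.
    rewrite -cat_cons; apply: Permutation_trans (Permutation_app_head B pQ) _.
    by apply: Permutation_sym; exact: Permutation_middle.
  by case/andP => -> /nQ.
elim: w Th => [|a w IH] Th hT /=; first exact: hT.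
apply: IH => P pP nP; apply: PrD; first by apply: hT => //=; constructor.
apply: insP => Q pQ nQ; apply: hT; last exact: nQ.
by apply: Permutation_trans pQ _; constructor.
Qed.

(** Isolates, in an exponential, the contribution of the value at w itself. *)
Lemma part_sum_one w (g : seq T -> N) :
  part_sum w (fun P => if P is [:: B] then g B else 0) = if w is [::] then 0 else g w.
Proof.
(* Adding a letter turns the empty partition into one block: c becomes h [:: a]. *)
have gen c (h : seq T -> N) :
    part_sum w (fun P => match P with [::] => c | [:: B] => h B | _ => 0 end) =
    if w is [::] then c else h w.
  elim: w c h => [|a w IH] c h //=.
  transitivity (part_sum w (fun P =>
      match P with [::] => h [:: a] | [:: B] => h (a :: B) | _ => 0 end)).
    apply: part_sum_ext => -[|B [|C P]] _ _;
    rewrite /extend_sum /= ?addr0 ?signed0 ?addr0 ?add0r //.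
    have ins0 Q : insert_sum a (fun=> 0 : N) Q = 0.
      by elim: Q => //= D Q ->; rewrite signed0 addr0.
    by rewrite ins0 !signed0.
  by rewrite IH; case: (w).
exact: gen.
Qed.

End PartSumTheory.

Lemma raddf_insert_sum (M N : zmodType) (f : {additive M -> N}) a Th P :
  f (insert_sum a Th P) = insert_sum a (f \o Th) P.
Proof.
by elim: P Th => [|B P IH] Th /=; rewrite ?raddf0 // raddfD raddf_signed IH.
Qed.

Lemma raddf_part_sum (M N : zmodType) (f : {additive M -> N}) w Th :
  f (part_sum w Th) = part_sum w (fun P => f (Th P)).
Proof.
elim: w Th => [|a w IH] Th //=; rewrite IH; congr part_sum; apply: funext => P.
by rewrite raddfD raddf_insert_sum.
Qed.


Lemma wpar_flatten P : wpar p (flatten P) = wpar (wpar p) P.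
Proof. by elim: P => //= B P IH; rewrite wpar_cat IH. Qed.

(** Inserting a letter and unshuffling the blocks commute: the block that
    receives the letter lands in the left or in the right family. *)
Lemma insert_sum_unsh (N : zmodType) a P (Z : seq (seq T) -> seq (seq T) -> N) :
  insert_sum a (fun Q => unsh_sum (wpar p) Q Z) P =
  unsh_sum (wpar p) P (fun L R => insert_sum a (Z^~ R) L +
                         signed (p a && wpar (wpar p) L) (insert_sum a (Z L) R)).
Proof.
elim: P Z => [|B P IH] Z /=; first by rewrite signed0 addr0.
rewrite insert_sumD !IH -!unsh_sumD unsh_sum_signed -!unsh_sumD.
apply: unsh_sum_ext => l r _.
have -> : insert_sum a (fun L => signed (wpar p B && wpar (wpar p) L) (Z L (B :: r))) l =
    signed (wpar p B && (p a (+) wpar (wpar p) l)) (insert_sum a (Z^~ (B :: r)) l).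
  rewrite -insert_sum_signed; apply: insert_sum_ext => Q /(wpar_perm p) pQ _.
  by rewrite -wpar_flatten pQ /= wpar_flatten.
rewrite insert_sum_signed !signedD !signedA !addrA [LHS](ACl (1*3*4*5*2*6)) /=.
congr (_ + _ + signed _ _ + signed _ _ + signed _ _ + signed _ _).
- by case: (p a); case: (wpar p B).
- by case: (p a); case: (wpar p B); case: (wpar (wpar p) l).
- by case: (p a); case: (wpar p B); case: (wpar (wpar p) l).
by case: (p a); case: (wpar p B); case: (wpar (wpar p) l).
Qed.

Lemma part_sum_extend (N : zmodType) w a P (F : seq (seq T) -> seq (seq T) -> N) :
  part_sum w (fun R => extend_sum a (F^~ R) P) = extend_sum a (fun L => part_sum w (F L)) P.
Proof.
rewrite /extend_sum part_sumD; congr (_ + _).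
elim: P F => [|B P IH] F /=; first exact: part_sum0.
by rewrite part_sumD part_sum_signed IH.
Qed.

(** Partitioning w and then dealing the blocks into two families amounts to
    dealing the letters first and partitioning each part.  This is the
    compatibility of the coalgebra morphism below with the coproducts, and the
    multiplicativity of the exponential. *)
Lemma part_sum_unsh (N : zmodType) w (Z : seq (seq T) -> seq (seq T) -> N) :
  part_sum w (fun P => unsh_sum (wpar p) P Z) =
  unsh_sum p w (fun l r => part_sum l (fun L => part_sum r (fun R => Z L R))).
Proof.
elim: w Z => [|a w IH] Z //=.
have -> : extend_sum a (fun P => unsh_sum (wpar p) P Z) = fun P => unsh_sum (wpar p) P
    (fun L R => extend_sum a (Z^~ R) L + signed (p a && wpar (wpar p) L) (extend_sum a (Z L) R)).
  apply: funext => P; rewrite /extend_sum insert_sum_unsh /= -!unsh_sumD;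
    apply: unsh_sum_ext => l r _.
  by rewrite !signedD addbF addrACA.
rewrite IH -unsh_sumD; apply: unsh_sum_ext => l r _.
rewrite -part_sum_signed -part_sumD; apply: part_sum_ext => P /(wpar_perm p) pP _.
rewrite -pP wpar_flatten part_sumD part_sum_signed /=; congr (_ + _).
by rewrite part_sum_extend.
Qed.

Section Compat.
Variable N : zmodType.
Implicit Types Th : seq (seq T) -> N.

(** The two symmetries of a function of partitions that make its partition sum
    graded symmetric: under exchange of adjacent blocks, and of adjacent letters
    inside a block. *)
Definition blockC Th := forall P Q B C,
  Th (P ++ B :: C :: Q) = signed (wpar p B && wpar p C) (Th (P ++ C :: B :: Q)).

Definition letterC Th := forall P Q u w a b,
  Th (P ++ (u ++ a :: b :: w) :: Q) =
  signed (p a && p b) (Th (P ++ (u ++ b :: a :: w) :: Q)).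

Lemma insert_sum_cat a Th P Q :
  insert_sum a Th (P ++ Q) = insert_sum a (fun P' => Th (P' ++ Q)) P +
    signed (p a && wpar (wpar p) P) (insert_sum a (fun Q' => Th (P ++ Q')) Q).
Proof.
elim: P Th => [|B P IH] Th /=; first by rewrite andbF add0r.
by rewrite IH signedD signedA addrA -andb_addr.
Qed.

Lemma extend_sum_blockC a Th : blockC Th -> blockC (extend_sum a Th).
Proof.
move=> hB P Q B C; rewrite /extend_sum !insert_sum_cat /= !signedD.
rewrite (hB ([:: a] :: P)) /=; congr (_ + (_ + _)).
  by rewrite -insert_sum_signed; apply: insert_sum_ext => P' _ _; rewrite hB.
rewrite (hB P Q (a :: B) C) (hB P Q B (a :: C)) /= !signedA.
have -> : insert_sum a (fun R => Th (P ++ B :: C :: R)) Q =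
  signed (wpar p B && wpar p C) (insert_sum a (fun R => Th (P ++ C :: B :: R)) Q).
  by rewrite -insert_sum_signed; apply: insert_sum_ext => P' _ _; rewrite hB.
rewrite !signedA [RHS]addrCA; congr (signed _ _ + (signed _ _ + signed _ _)).
- by case: (p a); case: (wpar p B); case: (wpar p C); case: (wpar _ P).
- by case: (p a); case: (wpar p B); case: (wpar p C); case: (wpar _ P).
by case: (p a); case: (wpar p B); case: (wpar p C); case: (wpar _ P).
Qed.

Lemma wpar_swap u w a b : wpar p (u ++ a :: b :: w) = wpar p (u ++ b :: a :: w).
Proof. by rewrite !wpar_cat /= [p a (+) _]addbCA. Qed.

Lemma extend_sum_letterC a Th : letterC Th -> letterC (extend_sum a Th).
Proof.
move=> hL P Q u w x y; rewrite /extend_sum !insert_sum_cat /= !signedD.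
rewrite (hL ([:: a] :: P)) wpar_swap /=; congr (_ + (_ + _)).
  by rewrite -insert_sum_signed; apply: insert_sum_ext => P' _ _; rewrite hL.
have := hL P Q (a :: u) w x y => /= ->; rewrite !signedA.
have -> : insert_sum a (fun R => Th (P ++ (u ++ [:: x, y & w]) :: R)) Q =
  signed (p x && p y) (insert_sum a (fun R => Th (P ++ (u ++ [:: y, x & w]) :: R)) Q).
  by rewrite -insert_sum_signed; apply: insert_sum_ext => P' _ _; rewrite hL.
rewrite !signedA; set b1 := p x && p y; set b2 := _ && wpar (wpar p) P; set b3 := _ && wpar p _.
by congr (signed _ _ + signed _ _); case: b1; case: b2; case: b3.
Qed.

(** Two letters inserted one after the other either meet in a block, where
    letterC exchanges them, or occupy two blocks, where only the sign differs. *)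
Lemma insert_sumC a b Th P : letterC Th ->
  insert_sum b (insert_sum a Th) P = signed (p a && p b) (insert_sum a (insert_sum b Th) P).
Proof.
elim: P Th => [|B P IH] Th hL /=; first by rewrite signed0.
rewrite !insert_sumD !insert_sum_signed /= IH => [|R Q]; last exact: (hL (B :: R)).
rewrite (hL [::] P [::] B b a) !signedD !signedA /=.
rewrite !addrA [RHS](ACl (1*3*2*4)) /=.
congr (_ + signed _ _ + signed _ _ + signed _ _); case: (p a); case: (p b) => //=;
  by case: (wpar p B).
Qed.

Lemma part_sum_swap u w a b Th : blockC Th -> letterC Th ->
  part_sum (u ++ a :: b :: w) Th = signed (p a && p b) (part_sum (u ++ b :: a :: w) Th).
Proof.
elim: u Th => [|c u IH] Th hB hL /=; last first.
  by apply: IH; [apply: extend_sum_blockC|apply: extend_sum_letterC].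
rewrite -part_sum_signed; congr part_sum; apply: funext => P.
have ins1 x y Q : insert_sum x (extend_sum y Th) Q =
    insert_sum x (fun R => Th ([:: y] :: R)) Q + insert_sum x (insert_sum y Th) Q.
  exact: insert_sumD.
rewrite {1 3}/extend_sum !ins1 /extend_sum /= insert_sumC // !addbF.
have := hB [::] P [:: a] [:: b]; have := hL [::] P [::] [::] a b.
rewrite /= !addbF => -> ->; rewrite !signedD !signedA !addrA [RHS](ACl (1*2*4*3*5)) /=.
by congr (_ + _ + signed _ _ + _ + _); case: (p a); case: (p b).
Qed.

End Compat.

Section Linear.
Variables (K : pzRingType) (N : lmodType K) (c : K) (a a1 a2 : T).
Hypotheses (pa1 : p a1 = p a) (pa2 : p a2 = p a).
Implicit Types Th : seq (seq T) -> N.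

(** One condition covers linearity in a letter and, with c = 0, the replacement
    of a letter by another one. *)
Definition letterL Th := forall P Q u w,
  Th (P ++ (u ++ a :: w) :: Q) =
  c *: Th (P ++ (u ++ a1 :: w) :: Q) + Th (P ++ (u ++ a2 :: w) :: Q).

Lemma insert_sumZ b Th P : insert_sum b (fun Q => c *: Th Q) P = c *: insert_sum b Th P.
Proof. by rewrite (raddf_insert_sum ( *:%R c)). Qed.

Lemma part_sumZ w Th : part_sum w (fun Q => c *: Th Q) = c *: part_sum w Th.
Proof. by rewrite (raddf_part_sum ( *:%R c)). Qed.

Lemma extend_sum_letterL b Th : letterL Th -> letterL (extend_sum b Th).
Proof.
move=> hL P Q u w; rewrite /extend_sum !insert_sum_cat /=.
have wpE x : p x = p a -> wpar p (u ++ x :: w) = wpar p (u ++ a :: w).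
  by move=> px; rewrite !wpar_cat /= px.
rewrite !wpE //; set s1 := _ && _; set s2 := _ && _.
have h1 := hL ([:: [:: b]] ++ P) Q u w.
have h2 : insert_sum b (fun P' => Th (P' ++ (u ++ a :: w) :: Q)) P =
    c *: insert_sum b (fun P' => Th (P' ++ (u ++ a1 :: w) :: Q)) P +
    insert_sum b (fun P' => Th (P' ++ (u ++ a2 :: w) :: Q)) P.
  by rewrite -insert_sumZ -insert_sumD; apply: insert_sum_ext => R _ _; exact: hL.
have h3 := hL P Q (b :: u) w.
have h4 : insert_sum b (fun R => Th (P ++ (u ++ a :: w) :: R)) Q =
    c *: insert_sum b (fun R => Th (P ++ (u ++ a1 :: w) :: R)) Q +
    insert_sum b (fun R => Th (P ++ (u ++ a2 :: w) :: R)) Q.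
  by rewrite -insert_sumZ -insert_sumD; apply: insert_sum_ext => R _ _; exact: hL.
rewrite /= in h1 h3; rewrite h1 h2 h3 h4 !signedD !scalerDr -!signedZ !addrA.
by rewrite [LHS](ACl (1*3*5*7*2*4*6*8)).
Qed.

Lemma part_sum_lin u w Th : letterL Th ->
  part_sum (u ++ a :: w) Th = c *: part_sum (u ++ a1 :: w) Th + part_sum (u ++ a2 :: w) Th.
Proof.
elim: u Th => [|b u IH] Th hL /=; last by apply: IH; exact: extend_sum_letterL.
rewrite -part_sumZ -part_sumD; congr part_sum; apply: funext => P.
rewrite /extend_sum (hL [::] P [::] [::]) /= scalerDr -!addrA; congr (_ + _).
rewrite addrCA; congr (_ + _); elim: P Th hL => [|B P IH] Th hL /=.
  by rewrite scaler0 addr0.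
rewrite IH => [|R]; last exact: (hL (B :: R)).
rewrite (hL [::] P [::]) /= pa1 pa2 signedD !signedZ scalerDr -!addrA; congr (_ + _).
by rewrite addrCA.
Qed.

End Linear.


End PartSum.

(** * Power series and Koszul brackets *)

Section Cauchy.
Variable N : zmodType.
Implicit Types (F : nat -> nat -> N).

(** All operations on series have coefficients of this form; laws proved for it
    spare every later computation the truncated differences of indices. *)
Definition cauchy F (n : nat) : N := \sum_(i < n.+1) F i (n - i)%N.

Lemma cauchy_ext F G n : (forall i j, (i + j = n)%N -> F i j = G i j) ->
  cauchy F n = cauchy G n.
Proof. by move=> FG; apply: eq_bigr => i _; apply: FG; rewrite subnKC // -ltnS. Qed.

Lemma cauchyS F n : cauchy F n.+1 = F 0%N n.+1 + cauchy (fun i j => F i.+1 j) n.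
Proof. by rewrite /cauchy big_ord_recl subn0. Qed.

Lemma cauchyn0 F : cauchy F 0 = F 0%N 0%N.
Proof. by rewrite /cauchy big_ord1. Qed.

Lemma cauchySr F n : cauchy F n.+1 = cauchy (fun i j => F i j.+1) n + F n.+1 0%N.
Proof.
rewrite /cauchy big_ord_recr /= subnn; congr (_ + _).
by apply: eq_bigr => i _; rewrite subSn // -ltnS.
Qed.

Lemma cauchyC F n : cauchy F n = cauchy (fun i j => F j i) n.
Proof.
elim: n F => [|n IH] F; first by rewrite !cauchyn0.
by rewrite cauchyS cauchySr IH addrC.
Qed.

Lemma cauchyD F G n : cauchy (fun i j => F i j + G i j) n = cauchy F n + cauchy G n.
Proof. exact: big_split. Qed.

Lemma cauchy0 F n : (forall i j, (i + j = n)%N -> F i j = 0) -> cauchy F n = 0.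
Proof. by move=> F0; rewrite (cauchy_ext F0) /cauchy big1. Qed.

(** Both sides sum G i j l over i + j + l = n. *)
Lemma cauchyA (G : nat -> nat -> nat -> N) n :
  cauchy (fun i m => cauchy (G i) m) n = cauchy (fun m l => cauchy (fun i j => G i j l) m) n.
Proof.
elim: n G => [|n IH] G; first by rewrite !cauchyn0.
rewrite cauchyS IH [RHS]cauchyS cauchyn0 cauchyS -addrA; congr (_ + _).
by rewrite -cauchyD; apply: cauchy_ext => i j _; rewrite cauchyS.
Qed.

Lemma cauchy_single F a b : (forall i j, (i + j = a + b)%N -> i != a -> F i j = 0) ->
  cauchy F (a + b) = F a b.
Proof.
move=> F0; have la : (a < (a + b).+1)%N by rewrite ltnS leq_addr.
rewrite /cauchy (bigD1 (Ordinal la)) //= addKn big1 ?addr0 // => i ia.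
by apply: F0 => //; rewrite subnKC // -ltnS.
Qed.

End Cauchy.

Lemma raddf_cauchy (M N : zmodType) (f : {additive M -> N}) F n :
  f (cauchy F n) = cauchy (fun i j => f (F i j)) n.
Proof. exact: raddf_sum. Qed.

Lemma morph_cauchy (M N : zmodType) (f : M -> N) F n :
  {morph f : x y / x + y} -> f (cauchy F n) = cauchy (fun i j => f (F i j)) n.
Proof.
move=> fD; have f0 : f 0 = 0.
  by apply: (addIr (f 0)); rewrite add0r -fD addr0.
exact: big_morph.
Qed.

Definition oddz (i : int) : bool := odd `|i|%N.

Lemma oddzD i j : oddz (i + j) = oddz i (+) oddz j.
Proof.
have oddzN m : oddz (- m) = oddz m by rewrite /oddz abszN.
have oddzB (m n : nat) : oddz (m%:Z - n%:Z) = odd m (+) odd n.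
  wlog le_nm : m n / (n <= m)%N => [W|].
    have [/W//|/ltnW/W] := leqP n m.
    by rewrite -opprB oddzN addbC.
  by rewrite /oddz subzn // absz_nat oddB.
case: i => m; case: j => n; rewrite ?NegzE ?oddzN.
- by rewrite -PoszD /oddz !absz_nat oddD.
- by rewrite oddzB.
- by rewrite addrC oddzB addbC.
by rewrite -opprD oddzN -PoszD /oddz !absz_nat oddD.
Qed.

Lemma oddzM i j : oddz (i * j) = oddz i && oddz j.
Proof. by rewrite /oddz abszM oddM. Qed.

Lemma signed_exprz (K : fieldType) (M : lmodType K) i (x : M) :
  (-1) ^ i *: x = signed (oddz i) x.
Proof.
have nat_sg n : ((-1) ^+ n : K) *: x = signed (odd n) x.
  by rewrite -signr_odd; case: (odd n); rewrite /signed ?expr1 ?scaleN1r ?expr0 ?scale1r.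
case: i => n; first exact: nat_sg.
by rewrite NegzE -exprz_inv invrN1 nat_sg.
Qed.

(** The iterated commutators of the Koszul brackets, for any product, with
    degrees recorded modulo 2; it serves both A and A[[t]]. *)
Fixpoint kbracket (M : zmodType) (mul : M -> M -> M) (one : M) (d : bool) (T : M -> M)
    (s : seq (bool * M)) : M :=
  if s is (b, x) :: s' then
    kbracket mul one (d (+) b) (fun z => T (mul x z) - signed (d && b) (mul x (T z))) s'
  else T one.

Section Graded.
Variables (K : fieldType) (A : gradedComAlg K).
Implicit Types (a u v : A) (b c : bool).

HB.instance Definition _ a := GRing.isLinear.Build K A A _ (gmul a) (gmul_linr a).
Definition gmulr u : A -> A := fun a => gmul a u.
Fact gmulr_linear u : linear (gmulr u). Proof. exact: gmul_linl. Qed.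
HB.instance Definition _ u := GRing.isLinear.Build K A A _ (gmulr u) (gmulr_linear u).

Lemma gmul0l a : gmul 0 a = 0.
Proof. exact: (raddf0 (gmulr a)). Qed.

Definition homog_par (b : bool) a : Prop := exists2 i, oddz i = b & homog i a.
(** Spans, unlike homogeneous elements, are closed under the sums over degrees
    that occur in the coefficients of a product of series. *)
Definition par_part (b : bool) : A -> Prop := Defs.span (homog_par b).

Lemma par_part_signed e b a : par_part b a -> par_part b (signed e a).
Proof. by case: e => // ?; apply: spanN. Qed.

Lemma gmul0r a : gmul a 0 = 0.
Proof. exact: raddf0. Qed.

Lemma par_part_mul b c x y : par_part b x -> par_part c y -> par_part (b (+) c) (gmul x y).
Proof.
elim=> [|e a x' [i <- ha] _ IH] hy; first by rewrite gmul0l; apply: span_zero.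
rewrite gmul_linl; apply: spanD; last exact: IH.
apply: spanZ; elim: hy => [|f u y' [j <- hu] _ IHy]; first by rewrite gmul0r; apply: span_zero.
rewrite gmul_linr; apply: span_step => //.
by exists (i + j); [exact: oddzD|exact: gmul_deg].
Qed.

Lemma par_part_comm b c x y : par_part b x -> par_part c y ->
  gmul x y = signed (b && c) (gmul y x).
Proof.
elim=> [|e a x' [i <- ha] _ IH] hy; first by rewrite gmul0l gmul0r signed0.
rewrite gmul_linl gmul_linr signedD signedZ IH //; congr (_ *: _ + _).
elim: hy => [|f u y' [j <- hu] _ IHy]; first by rewrite gmul0r gmul0l signed0.
rewrite gmul_linr gmul_linl signedD signedZ IHy; congr (_ *: _ + _).
by rewrite (gmulC ha hu) signed_exprz oddzM.
Qed.

Lemma gmulr1 a : gmul a (gone A) = a.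
Proof.
have [s _ ->] := gproj_sum a; rewrite -[LHS]/(gmulr _ _) raddf_sum /=.
apply: eq_bigr => i _; rewrite /gmulr.
rewrite (@gmulC _ A i 0) ?gone_deg ?mulr0 ?expr0z ?scale1r ?gmul1 //.
by rewrite /homog gprojE eqxx.
Qed.

Lemma koszul_kbracket d f (s : seq (int * A)) :
  koszul d f s = kbracket (@gmul K A) (gone A) (oddz d) f [seq (oddz e.1, e.2) | e <- s].
Proof.
elim: s d f => [|[i a] s IH] d f //=; rewrite IH oddzD; congr (kbracket _ _ _ _ _).
by apply: funext => x; rewrite signed_exprz oddzM.
Qed.

Notation S := (nat -> A).
Implicit Types (x y z : S).

Definition smul x y : S := fun n => cauchy (fun i j => gmul (x i) (y j)) n.
Definition sone : S := fun n => if n is 0%N then gone A else 0.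

Lemma smul_linear x : linear (smul x).
Proof.
move=> e y z; apply: funext => n.
transitivity (e *: smul x y n + smul x z n) => //.
rewrite /smul (raddf_cauchy ( *:%R e)) -cauchyD; apply: cauchy_ext => i j _.
exact: gmul_linr.
Qed.

HB.instance Definition _ x := GRing.isLinear.Build K S S _ (smul x) (smul_linear x).

Lemma smul1 x : smul x sone = x.
Proof.
apply: funext => n; rewrite /smul -[in LHS](addn0 n) cauchy_single ?gmulr1 // => i [|j] //=.
  by rewrite !addn0 => -> /eqP.
by rewrite raddf0.
Qed.

Definition series_par b x : Prop := forall n, par_part b (x n).

Lemma par_part_cauchy b (F : nat -> nat -> A) n :
  (forall i j, (i + j = n)%N -> par_part b (F i j)) -> par_part b (cauchy F n).
Proof.
move=> hF; rewrite /cauchy; apply: (big_ind (par_part b)); first exact: span_zero.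
  by move=> *; apply: spanD.
by move=> i _; apply: hF; rewrite subnKC // -ltnS.
Qed.

Lemma series_par_mul b c x y : series_par b x -> series_par c y ->
  series_par (b (+) c) (smul x y).
Proof. by move=> hx hy n; apply: par_part_cauchy => i j _; apply: par_part_mul. Qed.

Lemma signed_fun b x n : signed b x n = signed b (x n).
Proof. by case: b. Qed.

(** The commutativity of A in the form needed to move a factor past another one
    without an associativity law for series. *)
Lemma smulCA b c x y z : series_par b x -> series_par c y ->
  smul x (smul y z) = signed (b && c) (smul y (smul x z)).
Proof.
move=> hx hy; apply: funext => n; rewrite signed_fun /smul.
transitivity (cauchy (fun i m => cauchy (fun j l => gmul (x i) (gmul (y j) (z l))) m) n).
  by apply: cauchy_ext => i m _; rewrite raddf_cauchy.
transitivity (signed (b && c)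
    (cauchy (fun j m => cauchy (fun i l => gmul (y j) (gmul (x i) (z l))) m) n)); last first.
  by congr (signed _ _); apply: cauchy_ext => i m _; rewrite raddf_cauchy.
rewrite !cauchyA [RHS](morph_cauchy (f := signed _)) => [|u v]; last by rewrite signedD.
apply: cauchy_ext => m l _.
rewrite [in RHS]cauchyC [RHS](morph_cauchy (f := signed _)) => [|u v]; last by rewrite signedD.
apply: cauchy_ext => i j _.
by rewrite !gmulA (par_part_comm (hx i) (hy j)) -[gmul (signed _ _) _]/(gmulr _ _) raddf_signed.
Qed.


Definition sprod (X : seq (bool * S)) : S := foldr (fun e z => smul e.2 z) sone X.

Definition op_par d (T : S -> S) := forall c x, series_par c x -> series_par (d (+) c) (T x).

Lemma series_par_signed e b x : series_par b x -> series_par b (signed e x).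
Proof. by move=> hx n; rewrite signed_fun; apply: par_part_signed. Qed.

Lemma series_parB b x y : series_par b x -> series_par b y -> series_par b (x - y).
Proof. by move=> hx hy n; apply: spanD; [exact: hx|exact/spanN/hy]. Qed.

Lemma op_par_bracket d b T x : series_par b x -> op_par d T ->
  op_par (d (+) b) (fun z => T (smul x z) - signed (d && b) (smul x (T z))).
Proof.
move=> hx hT c z hz; apply: series_parB.
  by rewrite -addbA; apply/hT/series_par_mul.
by apply: series_par_signed; rewrite addbAC addbC; apply: series_par_mul => //; apply: hT.
Qed.

Lemma series_par_sone : series_par false sone.
Proof.
case=> [|n]; last exact: span_zero.
by apply: span_gen; exists 0 => //; apply: gone_deg.
Qed.

Notation good X := (List.Forall (fun e : bool * S => series_par e.1 e.2) X).

Lemma good_cons b x X : good ((b, x) :: X) -> series_par b x /\ good X.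
Proof. by move=> g; split; [exact: List.Forall_inv g|exact: List.Forall_inv_tail g]. Qed.

Lemma kbracket_par d T X : good X -> op_par d T ->
  series_par (d (+) wpar fst X) (kbracket smul sone d T X).
Proof.
elim: X d T => [|[b x] X IH] d T gX hT /=; first by apply/hT/series_par_sone.
have [hx gX'] := good_cons gX; rewrite addbA; apply: IH => //.
exact: op_par_bracket.
Qed.

(** Induction on the number of factors: T (x z) is [T, x] z plus, up to sign,
    x T z; the first term puts x into the bracket and the second one into the
    product, as an unshuffle does with its first letter. *)
Lemma apply_sprod d T X : good X -> op_par d T ->
  T (sprod X) = unsh_sum fst X (fun l r => smul (kbracket smul sone d T l) (sprod r)).
Proof.
elim: X d T => [|[b x] X IH] d T gX hT /=; first by rewrite smul1.
have [hx gX'] := good_cons gX.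
rewrite -[LHS](subrK (signed (d && b) (smul x (T (sprod X))))); congr (_ + _).
  rewrite -(IH _ (fun z => T (smul x z) - signed (d && b) (smul x (T z)))) //.
  exact: op_par_bracket.
rewrite (IH d T) // raddf_unsh_sum unsh_sum_signed; apply: unsh_sum_ext => l r lr.
have gl : good l.
  have := Permutation_Forall (Permutation_sym lr) gX'.
  by rewrite -[l ++ r]/(app l r) List.Forall_app => -[].
rewrite /= (smulCA _ hx (kbracket_par gl hT)) signedA; congr (signed _ _).
by case: b {hx gX}; case: d {hT}; case: (wpar _ l).
Qed.

(** The coefficients of the commutator of the operator with components Phi and
    the multiplication by the series x. *)
Definition bracket_series (Phi : nat -> A -> A) (e : bool) x : nat -> A -> A := fun q a =>
  cauchy (fun i l => Phi i (gmul (x l) a) - signed e (gmul (x l) (Phi i a))) q.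

Lemma fps_opE (Phi : nat -> A -> A) x n :
  fps_op Phi x n = cauchy (fun i m => Phi i (x m)) n.
Proof. by []. Qed.

Lemma fps_op_bracket (Phi : nat -> A -> A) e x z : (forall i, {morph Phi i : u v / u + v}) ->
  fps_op Phi (smul x z) - signed e (smul x (fps_op Phi z)) = fps_op (bracket_series Phi e x) z.
Proof.
move=> PD; apply: funext => n.
transitivity (fps_op Phi (smul x z) n - signed e (smul x (fps_op Phi z) n)).
  by case: e.
have -> : fps_op Phi (smul x z) n =
    cauchy (fun q j => cauchy (fun i l => Phi i (gmul (x l) (z j))) q) n.
  by rewrite -cauchyA fps_opE; apply: cauchy_ext => i m _; rewrite -morph_cauchy.
have -> : smul x (fps_op Phi z) n =
    cauchy (fun q j => cauchy (fun i l => gmul (x l) (Phi i (z j))) q) n.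
  under [RHS]cauchy_ext => q j _ do rewrite cauchyC.
  by rewrite -cauchyA /smul; apply: cauchy_ext => i m _; rewrite -raddf_cauchy.
have sgB (u : A) (F : nat -> nat -> A) k : u - signed e (cauchy F k) =
    u + cauchy (fun i j => - signed e (F i j)) k.
  by congr (_ + _); rewrite (morph_cauchy (f := fun v => - signed e v))
    // => a v; rewrite signedD opprD.
rewrite sgB -cauchyD fps_opE; apply: cauchy_ext => q j _; rewrite sgB -cauchyD.
by apply: cauchy_ext => i l _.
Qed.

Notation kbrA := (kbracket (@gmul K A) (gone A)).

Lemma kbracket_sum d n (T : 'I_n -> A -> A) s :
  kbrA d (fun a => \sum_(i < n) T i a) s = \sum_(i < n) kbrA d (T i) s.
Proof.
elim: s d T => [|[b x] s IH] d T //=; rewrite -IH; congr (kbracket _ _ _ _ _).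
apply: funext => a; rewrite raddf_sum sumrB; congr (_ - _).
by rewrite (big_morph _ (@signedD _ _) (@signed0 _ _)).
Qed.

Lemma kbracket0 d s : kbrA d (fun=> 0) s = 0.
Proof.
elim: s d => [|[b x] s IH] d //=; rewrite -[RHS](IH (d (+) b)).
by congr (kbracket _ _ _ _ _); apply: funext => a; rewrite gmul0r signed0 subr0.
Qed.

(** If the component of index i of an operator has no nonzero bracket in this
    number of arguments for i < q, and the series x_l is divisible by t^(m_l),
    then the bracket of the x_l is divisible by t^(q + sum m_l), with the leading
    coefficient given by the component q and the leading coefficients of the x_l.
    The commutator with x_1 has the same property with q + m_1 for q, whence the
    induction. *)
Lemma kbracket_lead d (Phi : nat -> A -> A) q (X : seq (bool * (nat * S))) :
  (forall i, {morph Phi i : u v / u + v}) ->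
  List.Forall (fun e => (forall r, (r < e.2.1)%N -> e.2.2 r = 0) /\
                        (forall r, homog_par e.1 (e.2.2 r))) X ->
  (forall i s, (i < q)%N -> List.Forall (fun e => homog_par e.1 e.2) s ->
     size s = size X -> kbrA d (Phi i) s = 0) ->
  forall r, (r <= q + \sum_(e <- X) e.2.1)%N ->
  kbracket smul sone d (fps_op Phi) [seq (e.1, e.2.2) | e <- X] r =
  if (r == q + \sum_(e <- X) e.2.1)%N then
    kbrA d (Phi q) [seq (e.1, e.2.2 e.2.1) | e <- X] else 0.
Proof.
elim: X d Phi q => [|[b [m x]] X IH] d Phi q PD gX P0 r /=.
  rewrite big_nil addn0 => rq; rewrite fps_opE -[r in LHS]addn0.
  have PD0 i : Phi i 0 = 0 by apply: (addIr (Phi i 0)); rewrite add0r -PD addr0.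
  rewrite cauchy_single => [|i [|j] /eqP]; last 2 first.
  - by rewrite !addn0 => /eqP -> /eqP.
  - by move=> _ _ /=; rewrite PD0.
  case: eqP => [->//|/eqP nrq]; apply: (P0 r [::]) => //.
  by rewrite ltn_neqAle nrq.
rewrite big_cons /= => rq.
have [[/= x0 hx] gX'] : ((forall r, (r < m)%N -> x r = 0) /\ (forall r, homog_par b (x r))) /\
    List.Forall (fun e => (forall r, (r < e.2.1)%N -> e.2.2 r = 0) /\
                        (forall r, homog_par e.1 (e.2.2 r))) X.
  by split; [exact: List.Forall_inv gX|exact: List.Forall_inv_tail gX].
have -> : (fun z => fps_op Phi (smul x z) - signed (d && b) (smul x (fps_op Phi z))) =
    fps_op (bracket_series Phi (d && b) x) by apply: funext => z; rewrite fps_op_bracket.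
have bracketE i s : kbrA (d (+) b) (bracket_series Phi (d && b) x i) s =
    cauchy (fun j l => kbrA d (Phi j) ((b, x l) :: s)) i.
  exact: kbracket_sum.
have term0 j l s : List.Forall (fun e => homog_par e.1 e.2) s -> size s = size X ->
    (j < q)%N || (l < m)%N -> kbrA d (Phi j) ((b, x l) :: s) = 0.
  move=> gs ss; case/orP => [jq|lm].
    by apply: P0 => //; [constructor => //; apply: hx|rewrite /= ss].
  have PD0 : Phi j 0 = 0 by apply: (addIr (Phi j 0)); rewrite add0r -PD addr0.
  rewrite x0 //= -[RHS](kbracket0 (d (+) b) s); congr (kbracket _ _ _ _ _).
  by apply: funext => a; rewrite !gmul0l PD0 signed0 subr0.
have cmp j l : (j + l = q + m)%N -> j != q -> (j < q)%N || (l < m)%N.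
  move=> jl; rewrite neq_ltn => /orP[->//|qj]; apply/orP; right.
  by rewrite -(ltn_add2l q) -jl ltn_add2r.
rewrite addnA in rq *.
rewrite (IH _ _ (q + m)%N) // => [|i u v|i s iq gs ss]; last 2 first.
- rewrite /bracket_series -cauchyD; apply: cauchy_ext => j l _.
  by rewrite raddfD !PD raddfD signedD opprD addrACA.
- rewrite bracketE; apply: cauchy0 => j l jl; apply: term0 => //.
  by case: ltnP => //= qj; rewrite -(ltn_add2l q); apply: leq_ltn_trans iq; rewrite -jl leq_add2r.
case: eqP => // _; rewrite bracketE cauchy_single //= => j l jl jq.
apply: (term0 j l); [|by rewrite size_map|exact: cmp].
elim: (X) gX' => [|e Y IHY] gY /=; constructor.
  exact: (proj2 (List.Forall_inv gY)).
exact: IHY (List.Forall_inv_tail gY).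
Qed.
End Graded.

(** * Linear selections and homology representatives *)

Section Selection.
Variables (K : fieldType) (X Y : lmodType K) (R : X -> Y -> Prop).
Hypothesis R0 : R 0 0.
Hypothesis RP : forall c x y x' y', R x y -> R x' y' -> R (c *: x + x') (c *: y + y').

Let pgraph (G : set (X * Y)) : Prop :=
  [/\ forall c x y x' y', G (x, y) -> G (x', y') -> G (c *: x + x', c *: y + y'),
      forall x y y', G (x, y) -> G (x, y') -> y = y'
    & forall x y y', G (x, y) -> R x y' -> R x y].

Let RB x y x' y' : R x y -> R x' y' -> R (x - x') (y - y').
Proof. by move=> r r'; rewrite ![_ - _]addrC -!scaleN1r; apply: RP. Qed.

(** A maximal functional linear subspace of X * Y that refines R wherever R has
    a value is the graph of a total map.  A partial R describes a
    choice that is possible on a subspace only. *)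
Lemma linear_selection : exists f : {linear X -> Y}, forall x y, R x y -> R x (f x).
Proof.
have [F FP Ftot|G [[GP Gf GR] Gmax]] := @Zorn_bigcup (X * Y)%type pgraph.
  have two z z' : (\bigcup_(G in F) G)%classic z -> (\bigcup_(G in F) G)%classic z' ->
      exists2 G, F G & G z /\ G z'.
    move=> [G FG Gz] [G' FG' Gz'].
    by have [s|s] := Ftot _ _ FG FG'; [exists G'|exists G] => //; split=> //; apply: s.
  split=> [c x y x' y' h h'|x y y' h h'|x y y' [G FG Gxy]].
  - by have [G FG [g g']] := two _ _ h h'; exists G => //; have [GP _ _] := FP _ FG; apply: GP.
  - by have [G FG [g g']] := two _ _ h h'; have [_ Gf _] := FP _ FG; apply: Gf g g'.
  - by have [_ _ GR] := FP _ FG; apply: GR Gxy.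
have G0 : G (0, 0).
  apply: contrapT => nG0; apply: (Gmax [set (0, 0)]%classic).
    split=> [[x y] Gxy|/(_ (0, 0))]; last by move=> /(_ erefl).
    by case: nG0; have := GP (-1) _ _ _ _ Gxy Gxy; rewrite !scaleN1r !addNr.
  split=> [c x y x' y' [-> ->] [-> ->]|x y y' [_ ->] [_ ->]|x y y' [-> ->]] //.
  by rewrite !scaler0 !addr0.
have GZ c x y : G (x, y) -> G (c *: x, c *: y).
  by move=> g; have := GP c _ _ _ _ g G0; rewrite !addr0.
have GB x y x' y' : G (x, y) -> G (x', y') -> G (x - x', y - y').
  by move=> r r'; rewrite ![_ - _]addrC -!scaleN1r; apply: GP.
have RZ c x y : R x y -> R (c *: x) (c *: y).
  by move=> r; have := RP c r R0; rewrite !addr0.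
have tot x0 : exists y, G (x0, y).
  apply: contrapT => nx0.
  (* If some x0 + x with x in the domain of G has an R-value u, then y0 must be
     u - y; R being linear, this works for all other x as well. *)
  have [y0 y0P] : exists y0, forall x y u, G (x, y) -> R (x0 + x) u -> R (x0 + x) (y0 + y).
    have [[x [y [u [g r]]]]|no] := pselect (exists x y u, G (x, y) /\ R (x0 + x) u); last first.
      by exists 0 => x y u g r; case: no; exists x, y, u.
    exists (u - y) => x' y' u' g' r'.
    have := GR _ _ _ (GB _ _ _ _ g' g) _ => /(_ (u' - u)).
    have -> : x' - x = (x0 + x') - (x0 + x) by rewrite opprD addrACA subrr add0r.
    move=> /(_ (RB r' r)) r''; have := RP 1 r'' r.
    by rewrite !scale1r subrK [y' - y + u]addrAC [y' + u]addrC addrAC.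
  pose B : set (X * Y) := fun z => exists c x y, G (x, y) /\ z = (c *: x0 + x, c *: y0 + y).
  apply: (Gmax B).
    split=> [[x y] g|/(_ (x0, y0))]; first by exists 0, x, y; rewrite !scale0r !add0r.
    move=> BG; apply: nx0; exists y0; apply: BG.
    by exists 1, 0, 0; rewrite !scale1r !addr0.
  have Bfun c x y c' x' y' : G (x, y) -> G (x', y') ->
      c *: x0 + x = c' *: x0 + x' -> c *: y0 + y = c' *: y0 + y'.
    move=> g g' /eqP; rewrite -subr_eq0 opprD addrACA -scalerBl => /eqP e.
    have [cc'|ne] := eqVneq c c'.
      move: e; rewrite cc' subrr scale0r add0r => /eqP; rewrite subr_eq0 => /eqP e.
      by rewrite e in g; rewrite (Gf _ _ _ g g').
    case: nx0; exists ((c - c')^-1 *: (y' - y)).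
    have -> : x0 = (c - c')^-1 *: (x' - x).
      have -> : x' - x = (c - c') *: x0 by rewrite -[RHS]subr0 -e opprD addNKr opprB.
      by rewrite scalerA mulVf ?scale1r // subr_eq0.
    exact/GZ/GB.
  split=> [c _ _ _ _ [c1 [x [y [g [-> ->]]]]] [c2 [x' [y' [g' [-> ->]]]]]
          |_ _ _ [c1 [x [y [g [-> ->]]]]] [c2 [x' [y' [g' [e ->]]]]]
          |_ _ u [c1 [x [y [g [-> ->]]]]] r].
  - exists (c * c1 + c2), (c *: x + x'), (c *: y + y'); split; first exact: GP.
    by rewrite !scalerDr !scalerA !scalerDl addrACA [in X in (_, X)]addrACA.
  - exact: Bfun e.
  have [c0|nc] := eqVneq c1 0.
    by move: r; rewrite c0 !scale0r !add0r; apply: GR.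
  have := y0P _ _ (c1^-1 *: u) (GZ c1^-1 _ _ g).
  have -> : x0 + c1^-1 *: x = c1^-1 *: (c1 *: x0 + x).
    by rewrite scalerDr scalerA mulVf // scale1r.
  move=> /(_ (RZ _ _ _ r)) /(RZ c1).
  rewrite [c1 *: (c1^-1 *: (_ + _))]scalerA mulfV // scale1r.
  by rewrite [c1 *: (y0 + _)]scalerDr scalerA mulfV // scale1r.
pose f x := projT1 (cid (tot x)).
have fG x : G (x, f x) by exact: projT2 (cid (tot x)).
have f_lin : linear f by move=> c x y; apply: Gf (fG _) _; apply: GP.
pose F : {linear X -> Y} := HB.pack f (GRing.isLinear.Build K X Y _ f f_lin).
by exists F => x y; apply: GR (fG x).
Qed.

End Selection.

Section GradedMod.
Variables (K : fieldType) (V : gradedMod K).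

Lemma gproj_homog i (x : V) : homog i (gproj V i x).
Proof. by rewrite /homog gprojE eqxx. Qed.

Lemma gproj_id i (x : V) : homog i x -> gproj V i x = x.
Proof. by move/eqP. Qed.

Lemma gproj_out (x : V) s (j : int) : x = \sum_(i <- s) gproj V i x -> j \notin s ->
  gproj V j x = 0.
Proof.
move=> xE js; rewrite xE linear_sum big_seq big1 // => i si.
by rewrite gprojE; case: eqP => // ji; move: js; rewrite ji si.
Qed.

Lemma graded_ext (N : zmodType) (f g : {additive V -> N}) :
  (forall i x, homog i x -> f x = g x) -> f =1 g.
Proof.
move=> fg x; have [s _ ->] := gproj_sum x; rewrite !raddf_sum.
by apply: eq_bigr => i _; apply: fg (gproj_homog i x).
Qed.

(** A graded module is the direct sum of its components. *)
Lemma graded_lift (N : lmodType K) (G : int -> {linear V -> N}) :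
  exists L : {linear V -> N}, forall i x, L (gproj V i x) = G i (gproj V i x).
Proof.
pose spt x := s2val (cid2 (gproj_sum (x : V))).
have sptU x : uniq (spt x) by rewrite /spt; case: (cid2 _).
have sptE x : x = \sum_(i <- spt x) gproj V i x by rewrite /spt; case: (cid2 _).
pose L x := \sum_(i <- spt x) G i (gproj V i x).
have LE x t : uniq t -> {subset spt x <= t} -> L x = \sum_(i <- t) G i (gproj V i x).
  move=> ut st; rewrite [RHS](bigID (mem (spt x))) /= [X in _ + X]big1 => [|i it]; last first.
    by rewrite (gproj_out (sptE x)) // raddf0.
  rewrite addr0 -[RHS]big_filter; apply: perm_big; apply: uniq_perm => //.
    exact: filter_uniq.
  by move=> i; rewrite mem_filter; case: (boolP (i \in spt x)) => // /st ->.
have Ll : linear L.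
  move=> c x y; pose t := undup (spt (c *: x + y) ++ spt x ++ spt y).
  have ut : uniq t by exact: undup_uniq.
  rewrite !(LE _ t ut); try by move=> i ii; rewrite mem_undup !mem_cat ii ?orbT.
  rewrite scaler_sumr -big_split; apply: eq_bigr => i _.
  by rewrite !linearP.
pose F : {linear V -> N} := HB.pack L (GRing.isLinear.Build K V N _ L Ll).
exists F => i x; rewrite -[LHS]/(L _) (LE _ (undup (i :: spt (gproj V i x)))).
- rewrite (bigD1_seq i) ?undup_uniq ?mem_undup ?mem_head //= gprojE eqxx.
  rewrite big1 ?addr0 // => j /negPf ji; by rewrite gprojE ji raddf0.
- exact: undup_uniq.
by move=> j jj; rewrite mem_undup in_cons jj orbT.
Qed.

Variables (D : {linear V -> V}).
Hypotheses (D_deg : forall i x, homog i x -> homog (i + 1) (D x)).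
Hypothesis (D_sq : forall x, D (D x) = 0).

(** Over a field a linear map D has a linear map c with D c D = D; here c is
    assembled from choices in each degree, to lower degrees by one. *)
Lemma quasi_inverse : exists c : {linear V -> V},
  (forall i x, homog i x -> homog (i - 1) (c x)) /\ forall x, D (c (D x)) = D x.
Proof.
have correction i : exists f : {linear V -> V}, forall y x, homog (i - 1) x -> D x = y ->
    homog (i - 1) (f y) /\ D (f y) = y.
  have [||f fP] := @linear_selection K V V (fun y x => homog (i - 1) x /\ D x = y).
  - by split; rewrite ?raddf0 // /homog raddf0.
  - move=> c y x y' x' [/eqP hx <-] [/eqP hx' <-]; split; last by rewrite linearP.
    by rewrite /homog linearP hx hx'.
  by exists f => y x hx Dx; apply: (fP y x).
pose f i := projT1 (cid (correction i)).
have fP i y x : homog (i - 1) x -> D x = y -> homog (i - 1) (f i y) /\ D (f i y) = y.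
  exact: (projT2 (cid (correction i)) y x).
have [c cE] := graded_lift (fun i => gproj V (i - 1) \o f i).
exists c; split=> [i x hx|].
  by rewrite -(gproj_id hx) cE /=; apply: gproj_homog.
apply: (graded_ext (f := D \o c \o D)) => j x hx /=.
rewrite -(gproj_id (D_deg hx)) cE /=.
have := fP (j + 1) (D x) x; rewrite addrK => /(_ hx erefl) [hf Df].
by rewrite (gproj_id (D_deg hx)) gproj_id.
Qed.

(** With h := c D c, where D c D = D, the map p := (1 - D h) (1 - h D) is a
    projector onto a complement of the boundaries in the cycles. *)
Lemma homology_projector : exists p h : {linear V -> V},
  [/\ forall i x, homog i x -> homog i (p x),
      forall i x, homog i x -> homog (i - 1) (h x),
      forall x, D (p x) = 0, forall x, p (D x) = 0
    & forall x, p (p x) = p x] /\ forall x, D x = 0 -> x = p x + D (h x).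
Proof.
have [h [h_deg DhD hDh]] : exists h : {linear V -> V},
    [/\ forall i x, homog i x -> homog (i - 1) (h x),
        forall x, D (h (D x)) = D x & forall x, h (D (h x)) = h x].
  have [c [c_deg DcD]] := quasi_inverse; exists (c \o D \o c).
  split=> [i x /c_deg/D_deg/c_deg|x|x]; rewrite /= ?DcD //.
  by rewrite subrK.
pose p : {linear V -> V} := (idfun \- (D \o h)) \o (idfun \- (h \o D)).
have pE x : p x = x - h (D x) - D (h (x - h (D x))) by [].
have Dp x : D (p x) = 0 by rewrite pE [LHS]linearB linearB D_sq DhD subrr subr0.
have hp0 x : h (p x) = 0 by rewrite pE [LHS]linearB hDh subrr.
exists p, h; split; last first.
  by move=> x Dx; rewrite pE Dx linear0 subr0 subrK.
have homogB i (x y : V) : homog i x -> homog i y -> homog i (x - y).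
  by move=> /eqP hx /eqP hy; rewrite /homog linearB hx hy.
split=> // [i x hx|x|x].
- have hy : homog i (x - h (D x)).
    by apply: homogB => //; have := h_deg _ _ (D_deg hx); rewrite addrK.
  by rewrite pE; apply: homogB => //; have := D_deg (h_deg _ _ hy); rewrite subrK.
- by rewrite pE D_sq linear0 subr0 DhD subrr.
by rewrite [LHS]pE Dp linear0 subr0 hp0 linear0 subr0.
Qed.

End GradedMod.

Section Fixed.
Variables (K : fieldType) (V : gradedMod K) (p : {linear V -> V}).

Definition fixed : {pred V} := [pred x | p x == x].

Fact fixed_submod : submod_closed fixed.
Proof.
split=> [|c x y]; rewrite !inE ?raddf0 // => /eqP px /eqP py.
by rewrite linearP px py.
Qed.

HB.instance Definition _ := GRing.isSubmodClosed.Build K V fixed fixed_submod.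

Definition fixed_type := {x : V | x \in fixed}.
HB.instance Definition _ := SubChoice.on fixed_type.
HB.instance Definition _ := [SubChoice_isSubLmodule of fixed_type by <:].

Hypothesis p_deg : forall i x, homog i x -> homog i (p x).

Lemma p_gproj i x : gproj V i (p x) = p (gproj V i x).
Proof.
apply: (graded_ext (f := gproj V i \o p) (g := p \o gproj V i)) => j y hy /=.
rewrite -[in LHS](gproj_id (p_deg hy)) -[in RHS](gproj_id hy) !gprojE.
by case: eqP => // _; rewrite ?raddf0 // (gproj_id (p_deg hy)) gproj_id.
Qed.

Fact fix_proj_subproof i (x : fixed_type) : gproj V i (val x) \in fixed.
Proof. by rewrite inE -p_gproj (eqP (valP x)). Qed.

Definition fix_proj i (x : fixed_type) : fixed_type :=
  Sub (gproj V i (val x)) (fix_proj_subproof i x).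

Fact fix_proj_linear i : linear (fix_proj i).
Proof. by move=> c x y; apply: val_inj; rewrite /= !linearP. Qed.

HB.instance Definition _ i :=
  GRing.isLinear.Build K fixed_type fixed_type _ (fix_proj i) (fix_proj_linear i).

Fact fix_projE i j x :
  fix_proj i (fix_proj j x) = if i == j then fix_proj j x else 0.
Proof. by apply: val_inj; rewrite /= gprojE; case: eqP => // _; rewrite raddf0. Qed.

Fact fix_proj_sum x :
  exists2 s : seq int, uniq s & x = \sum_(i <- s) fix_proj i x.
Proof.
have [s us sx] := gproj_sum (val x); exists s => //.
by apply: val_inj; rewrite raddf_sum.
Qed.

Definition fixed_gmod : gradedMod K :=
  @GradedMod K fixed_type (fun i => fix_proj i) fix_projE fix_proj_sum.

End Fixed.

(** * Coalgebra morphisms and coderivations *)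

Lemma tens_lift (K : fieldType) (X Y M : lmodType K) (B : X -> Y -> M) :
  (forall y, linear (B^~ y)) -> (forall x, linear (B x)) ->
  exists k : {linear tens X Y -> M}, forall x y, k (tensor x y) = B x y.
Proof.
move=> Bl Br; pose f (z : X * Y) := B z.1 z.2.
have fR r : tens_rel r -> fglift f r = 0.
  have flin := fglift_linear f.
  have flE z : fglift f << z >> = f z by rewrite freeg.liftU scale1r.
  case=> [c x x' y|c x y y']; rewrite freeg.lift_is_additive flin !flE /f /=.
    by rewrite Bl subrr.
  by rewrite Br subrr.
pose k : {linear tens X Y -> M} := HB.pack (pres_lift f : tens X Y -> M)
  (GRing.isLinear.Build K (tens X Y) M _ (pres_lift f : tens X Y -> M) (pres_lift_linear fR)).
by exists k => x y; exact: (pres_liftE fR (x, y)).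
Qed.

Section Tensor0.
Variables (K : fieldType) (X Y : lmodType K).

Lemma tensor0l (y : Y) : tensor (0 : X) y = 0.
Proof.
have := tensorPl y 1 (0 : X) 0; rewrite scale1r addr0 scale1r => /eqP.
by rewrite -subr_eq0 opprD addNKr oppr_eq0 => /eqP.
Qed.

Lemma tensor0r (x : X) : tensor x (0 : Y) = 0.
Proof.
have := tensorPr x 1 (0 : Y) 0; rewrite scale1r addr0 scale1r => /eqP.
by rewrite -subr_eq0 opprD addNKr oppr_eq0 => /eqP.
Qed.

Fact tensorr_linear (x : X) : linear (@tensor K X Y x).
Proof. exact: tensorPr. Qed.
HB.instance Definition _ (x : X) :=
  GRing.isLinear.Build K Y (tens X Y) _ (tensor x) (tensorr_linear x).

Definition tensl (y : Y) : X -> tens X Y := fun x => tensor x y.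
Fact tensl_linear (y : Y) : linear (tensl y).
Proof. exact: tensorPl. Qed.
HB.instance Definition _ (y : Y) :=
  GRing.isLinear.Build K X (tens X Y) _ (tensl y) (tensl_linear y).

End Tensor0.

Lemma Sbar_ext (K : fieldType) (V : gradedMod K) (N : lmodType K)
  (f g : {linear Sbar V -> N}) :
  (forall w, f (wd w) = g (wd w)) -> f =1 g.
Proof.
move=> fg; apply: pres_ind => [|c w u IH]; first by rewrite !linear0.
by rewrite !linearP fg IH.
Qed.

Section SymCoalgebra.
Variables (K : fieldType) (V : gradedMod K).
Implicit Types (u v w l r : word V).

Definition lpar (a : int * V) : bool := oddz a.1.

Lemma wpar_lpar w : wpar lpar w = oddz (wdeg w).
Proof.
elim: w => [|a w IH] /=; first by rewrite wdeg_nil.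
by rewrite wdeg_cons oddzD IH.
Qed.

Lemma sum_unshuffles (N : lmodType K) (F : word V -> word V -> N) w :
  \sum_(t <- unshuffles w) (-1) ^ t.1 *: F t.2.1 t.2.2 = unsh_sum lpar w F.
Proof.
elim: w F => [|a w IH] F /=; first by rewrite big_seq1 scale1r.
rewrite big_cat !big_map -!IH /=; congr (_ + _); apply: eq_bigr => t _.
by rewrite ksignD -scalerA [X in _ *: X]signed_exprz oddzM wpar_lpar.
Qed.

Lemma coprodE w : coprod (wd w) = unsh_sum lpar w (fun l r => tensor (wd l) (wd r)).
Proof. by rewrite coprod_wd -sum_unshuffles. Qed.

Let prep0 i x w : Sbar V :=
  if w is [::] then 0 else (size w).+1%:R^-1 *: wd ((i, x) :: w).

Let prep0_cons i x u a w : prep0 i x (u ++ a :: w) =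
  (size u + (size w).+1).+1%:R^-1 *: wd (((i, x) :: u) ++ a :: w).
Proof. by case: u => [|b u] /=; rewrite ?size_cat. Qed.

Let prep0_compat i x : sym_compat (prep0 i x).
Proof.
split=> // [u w j c y z|u w j y|u w j m y z]; rewrite !prep0_cons.
- by rewrite wd_lin scalerDr !scalerA mulrC.
- by rewrite wd_proj.
by rewrite wd_swap !scalerA mulrC.
Qed.

Let prep i x : {linear Sbar V -> Sbar V} :=
  HB.pack (pres_lift (prep0 i x) : Sbar V -> Sbar V)
   (GRing.isLinear.Build K _ _ _ (pres_lift (prep0 i x) : Sbar V -> Sbar V)
     (sym_lift_linear (prep0_compat i x))).

Let prep_wd i x w : prep i x (wd w) = prep0 i x w.
Proof. exact: sym_liftE (prep0_compat i x) w. Qed.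

Let prep_linear i : linear (fun x => prep i x : Sbar V -> Sbar V).
Proof.
move=> c x y; apply: funext => u.
transitivity (c *: prep i x u + prep i y u) => //.
apply: (Sbar_ext (f := prep i (c *: x + y)) (g := (c \*: prep i x) \+ prep i y)) => w.
transitivity (c *: prep i x (wd w) + prep i y (wd w)) => //.
rewrite !prep_wd; case: w => [|a w] /=; first by rewrite scaler0 addr0.
by rewrite (wd_lin [::]) scalerDr !scalerA mulrC.
Qed.

Hypothesis charK : [pchar K] =i pred0.

(** In a graded symmetric word each of the letters can be moved to the front, so
    the unshuffles with a single letter on the left contribute size w copies.
    The prefix u collects the letters already passed. *)
Lemma sum_first_letter u w :
  unsh_sum lpar w (fun l r => if l is [:: b] then wd (u ++ b :: r) else 0) =
  (size w)%:R *: wd (u ++ w) :> Sbar V.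
Proof.
elim: w u => [|[i x] w IH] u /=; first by rewrite scale0r.
rewrite -natr1 scalerDl scale1r addrC; congr (_ + _).
  rewrite -cat_rcons -IH; apply: unsh_sum_ext => -[|[j y] [|e l]] r _ /=; rewrite ?signed0 //.
  by rewrite addbF cat_rcons [in RHS]wd_swap signed_exprz oddzM.
rewrite -(unsh_sum_nil lpar w (fun r => wd (u ++ (i, x) :: r) : Sbar V)).
by apply: unsh_sum_ext => -[|b l] r _.
Qed.

(** In characteristic zero every word is recovered from its coproduct or its
    corestriction: of the unshuffles of a word of length n > 1, those with one
    letter on the left, multiplied out, add up to n times the word.  The map k
    below performs this multiplication, with the factor 1/n, and I turns an
    element of V into the sum of its components, as words of length one. *)
Lemma coprod_corestr_inj (u : Sbar V) : coprod u = 0 -> corestr u = 0 -> u = 0.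
Proof.
have [L LE] := graded_lift (fun i => HB.pack (fun x => prep i x : Sbar V -> Sbar V)
  (GRing.isLinear.Build K V (Sbar V -> Sbar V) _ _ (prep_linear i)) :
  {linear V -> (Sbar V -> Sbar V)}).
have [I IE] := graded_lift (fun i => HB.pack (fun x => wd [:: (i, x)] : Sbar V)
  (GRing.isLinear.Build K V (Sbar V) _ (fun x => wd [:: (i, x)])
     (fun c x y => wd_lin [::] [::] i c x y)) : {linear V -> Sbar V}).
have Llin x : linear (L x).
  move=> c v w; have [s _ ->] := gproj_sum x; rewrite linear_sum.
  have E (z : Sbar V) : (\sum_(i <- s) L (gproj V i x)) z = \sum_(i <- s) prep i (gproj V i x) z.
    elim: (s) => [|i t IHt]; rewrite ?big_nil // !big_cons -IHt.
    by transitivity (L (gproj V i x) z + (\sum_(j <- t) L (gproj V j x)) z) => //; rewrite LE.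
  rewrite !E scaler_sumr -big_split; apply: eq_bigr => i _.
  by rewrite linearP.
have [v c x y|x|k kE] := tens_lift (B := fun a b : Sbar V => L (corestr a) b).
- by rewrite !linearP.
- exact: Llin.
move=> cu eu.
suff uE : u = k (coprod u) + I (corestr u) by rewrite uE cu eu !linear0 addr0.
move: u {cu eu}; apply: (Sbar_ext (f := idfun)
    (g := (k \o @coprod K V) \+ (I \o @corestr K V))) => w.
transitivity (k (coprod (wd w)) + I (corestr (wd w))) => //.
rewrite coprodE corestr_wd raddf_unsh_sum.
transitivity (unsh_sum lpar w (fun l r =>
    if l is [:: b] then prep0 b.1 b.2 r else 0) + I (letter w)); last first.
  congr (_ + _); apply: unsh_sum_ext => l r _.
  rewrite /= kE corestr_wd; case: l => [|b [|e l]]; rewrite /= ?linear0 //.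
  case: b => i x; rewrite LE -[RHS]/(prep i (gproj V i x) (wd r)) prep_wd.
  by case: r => //= b r; rewrite (wd_proj [::]).
case: w => [|[i x] [|b w]]; first by rewrite /= wd_nil linear0 addr0.
  by rewrite /= signed0 !add0r IE (wd_proj [::]).
set w' := _ :: _; rewrite [letter _]/(0 : V) linear0 addr0.
transitivity (unsh_sum lpar w' (fun l r => (size w')%:R^-1 *:
    (if l is [:: b] then wd ([::] ++ b :: r) else 0 : Sbar V))); last first.
  apply: unsh_sum_ext => -[|[j y] [|e l]] r /Permutation_length lr; rewrite ?scaler0 //.
  have {lr} : (size r).+1 = size w' by exact: lr.
  by case: r => //= a r ->.
rewrite unsh_sumZ sum_first_letter scalerA mulVf ?scale1r //.
by have /pcharf0P -> := charK.
Qed.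

Variable W : gradedMod K.

(** A map that behaves like a coderivation has primitive values on a word once it
    vanishes on shorter ones; with zero corestriction it vanishes there too. *)
Lemma coder_along_zero (D : {linear Sbar W -> Sbar V}) :
  (forall w : word W, (forall w' : word W, (size w' < size w)%N -> D (wd w') = 0) ->
     coprod (D (wd w)) = 0) ->
  (forall w : word W, corestr (D (wd w)) = 0) -> forall x, D x = 0.
Proof.
move=> Dc D1; apply: (Sbar_ext (V := W) (f := D) (g := \0)) => w; rewrite -[RHS]/0.
have [n] := ubnP (size w); elim: n w => // n IH w; rewrite ltnS => wn.
apply: coprod_corestr_inj => //; apply: Dc => w' w'w.
by apply: IH; apply: leq_trans wn.
Qed.

End SymCoalgebra.

Section Morphism.
Variables (K : fieldType) (V W : gradedMod K) (f : word V -> W).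
Implicit Types (u w B : word V) (P Q : seq (word V)).
Hypothesis f_lin : forall u w i c x y, f (u ++ (i, c *: x + y) :: w) =
  c *: f (u ++ (i, x) :: w) + f (u ++ (i, y) :: w).
Hypothesis f_proj : forall u w i x,
  f (u ++ (i, x) :: w) = f (u ++ (i, gproj V i x) :: w).
Hypothesis f_swap : forall u w i j x y, f (u ++ [:: (i, x), (j, y) & w]) =
  (-1) ^ (i * j) *: f (u ++ [:: (j, y), (i, x) & w]).

Notation lparV := (@lpar K V).

Definition blocks P : word W := [seq (wdeg B, f B) | B <- P].

(** The coalgebra morphism with Taylor coefficients f: the blocks of each
    partition of w are replaced by single letters. *)
Definition coalg_word w : Sbar W := part_sum lparV w (fun P => wd (blocks P)).

Lemma wdeg_repl u w i x y : wdeg (u ++ (i, x : V) :: w) = wdeg (u ++ (i, y : V) :: w).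
Proof. by rewrite !wdeg_cat !wdeg_cons. Qed.

Lemma wd_scale (u w : word W) i c x :
  wd (u ++ (i, c *: x) :: w) = c *: wd (u ++ (i, x) :: w) :> Sbar W.
Proof.
have w0 : wd (u ++ (i, 0) :: w) = 0 :> Sbar W.
  have := wd_lin u w i 1 (0 : W) 0; rewrite scaler0 addr0 scale1r => /eqP.
  by rewrite -subr_eq0 opprD addNKr oppr_eq0 => /eqP.
by have := wd_lin u w i c x 0; rewrite w0 !addr0.
Qed.

Fact coalg_word_compat : sym_compat coalg_word.
Proof.
have L i c x y z : (forall u w, f (u ++ (i, x) :: w) =
    c *: f (u ++ (i, y) :: w) + f (u ++ (i, z) :: w)) ->
    letterL c (i, x) (i, y) (i, z) (fun P => wd (blocks P) : Sbar W).
  move=> fE P Q u w; rewrite /blocks !map_cat /= fE wd_lin.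
  by congr (_ *: wd (_ ++ (_, _) :: _) + wd (_ ++ (_, _) :: _)); apply: wdeg_repl.
split=> [|u w i c x y|u w i x|u w i j x y]; first exact: wd_nil.
- by apply: part_sum_lin => //; apply: L => u' w'.
- have := @part_sum_lin _ lparV K _ 0 (i, x) (i, gproj V i x) (i, gproj V i x) erefl erefl u w.
  move=> /(_ _ (fun P => wd (blocks P))); rewrite /coalg_word => -> //.
    by rewrite scale0r add0r.
  by apply: L => u' w'; rewrite scale0r add0r.
rewrite signed_exprz oddzM; apply: (part_sum_swap (p := lparV)) => [P Q B C|P Q u' w' a b].
  by rewrite /blocks !map_cat /= wd_swap signed_exprz oddzM !wpar_lpar.
case: a b => [a' xa] [b' xb]; rewrite /blocks !map_cat /= f_swap wd_scale signed_exprz oddzM.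
have -> : wdeg (u' ++ [:: (a', xa), (b', xb) & w']) =
    wdeg (u' ++ [:: (b', xb), (a', xa) & w']).
  by rewrite !wdeg_cat !wdeg_cons [a' + _]addrCA.
by [].
Qed.

Definition coalg_mor : {linear Sbar V -> Sbar W} :=
  HB.pack (pres_lift coalg_word : Sbar V -> Sbar W)
   (GRing.isLinear.Build K _ _ _ (pres_lift coalg_word : Sbar V -> Sbar W)
     (sym_lift_linear coalg_word_compat)).

Lemma coalg_mor_wd w : coalg_mor (wd w) = coalg_word w.
Proof. exact: sym_liftE coalg_word_compat w. Qed.

Lemma coalg_mor_deg d x : Sbar_deg d x -> Sbar_deg d (coalg_mor x).
Proof.
elim=> [|c _ y [w wd_d ->] _ IH]; first by rewrite linear0; apply: span_zero.
rewrite linearP; apply: spanD => //; apply: spanZ; rewrite coalg_mor_wd /coalg_word.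
apply: part_sum_closed; [exact: span_zero|by move=> *; apply: spanD|by move=> *; apply: spanN|].
move=> P Pw _; apply: span_gen; exists (blocks P) => //; rewrite -wd_d.
have <- : wdeg (flatten P) = wdeg w.
  elim: Pw => // [a u u' _ IHp|a b u|u u' u'' _ -> //].
    by rewrite !wdeg_cons IHp.
  by rewrite !wdeg_cons addrCA.
by elim: P {Pw} => [|B P IHP] /=; rewrite ?wdeg_nil // wdeg_cat wdeg_cons IHP.
Qed.

Lemma coalg_mor_coprod x : coprod (coalg_mor x) = tmap coalg_mor coalg_mor (coprod x).
Proof.
move: x; apply: (Sbar_ext (f := @coprod K W \o coalg_mor)
    (g := tmap coalg_mor coalg_mor \o @coprod K V)) => w.
transitivity (coprod (coalg_mor (wd w))) => //.
transitivity (tmap coalg_mor coalg_mor (coprod (wd w))) => //.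
rewrite coprodE coalg_mor_wd /coalg_word (raddf_part_sum _ (@coprod K W)) raddf_unsh_sum.
transitivity (part_sum lparV w (fun P => unsh_sum (wpar lparV) P
    (fun L R => tensor (wd (blocks L)) (wd (blocks R))) : tens (Sbar W) (Sbar W))).
  congr (part_sum _ _ _); apply: funext => P.
  rewrite -[LHS]/(coprod (wd (blocks P))) coprodE /blocks unsh_sum_map.
  have -> // : @lpar K W \o (fun B => (wdeg B, f B)) = wpar lparV.
  by apply: funext => B; rewrite /= wpar_lpar.
rewrite part_sum_unsh; congr (unsh_sum _ _ _); apply: funext => l; apply: funext => r.
rewrite -[RHS]/(tmap coalg_mor coalg_mor (tensor (wd l) (wd r))) tmapE !coalg_mor_wd /coalg_word.
rewrite -[RHS]/(tensl _ _) raddf_part_sum; congr (part_sum _ _ _); apply: funext => L.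
by rewrite -(raddf_part_sum lparV (tensor (wd (blocks L)))).
Qed.

End Morphism.

(** * The degeneration property: closed lifts and absence of torsion *)

Section Series.
Variables (K : fieldType) (A : gradedComAlg K) (k : int).
Notation S := (nat -> A).
Implicit Types (x y z : S) (a : A) (d : int).

Definition coef n : S -> A := fun x => x n.
Fact coef_linear n : linear (coef n). Proof. by []. Qed.
HB.instance Definition _ n := GRing.isLinear.Build K S A _ (coef n) (coef_linear n).

Definition smull y : S -> S := fun x => smul x y.
Fact smull_linear y : linear (smull y).
Proof.
move=> e x z; apply: funext => n.
transitivity (e *: smul x y n + smul z y n) => //.
rewrite /smull /smul (raddf_cauchy ( *:%R e)) -cauchyD; apply: cauchy_ext => i j _.
exact: gmul_linl.
Qed.
HB.instance Definition _ y := GRing.isLinear.Build K S S _ (smull y) (smull_linear y).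

Definition tmul x : S := fun n => if n is m.+1 then x m else 0.
Fixpoint tpow m x : S := if m is m'.+1 then tmul (tpow m' x) else x.

Lemma tpow_lt m x r : (r < m)%N -> tpow m x r = 0.
Proof. by elim: m r => // m IH [|r] //= rm; apply: IH. Qed.

Lemma tpow_add m x r : tpow m x (m + r) = x r.
Proof. by elim: m => //= m IH. Qed.

Lemma tpowS m x : tpow m.+1 x = tpow m (tmul x).
Proof. by elim: m => //= m <-. Qed.

Fact tpow_linear m : linear (tpow m).
Proof.
move=> e x y; elim: m => //= m IH; apply: funext => -[|n] /=.
  by rewrite -[RHS]/(e *: 0 + 0) scaler0 addr0.
by rewrite IH.
Qed.
HB.instance Definition _ m := GRing.isLinear.Build K S S _ (tpow m) (tpow_linear m).

Lemma homogD d (u v : A) : homog d u -> homog d v -> homog d (u + v).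
Proof. by move=> /eqP hu /eqP hv; rewrite /homog linearD hu hv. Qed.

Lemma homogN d (u : A) : homog d u -> homog d (- u).
Proof. by move=> /eqP hu; rewrite /homog linearN hu. Qed.

Lemma homog0 d : homog d (0 : A).
Proof. by rewrite /homog linear0. Qed.

Lemma homogZ d e (u : A) : homog d u -> homog d (e *: u).
Proof. by move=> /eqP hu; rewrite /homog linearZ /= hu. Qed.

Lemma homog_cauchy d (F : nat -> nat -> A) n :
  (forall i j, (i + j = n)%N -> homog d (F i j)) -> homog d (cauchy F n).
Proof.
move=> hF; rewrite /cauchy; apply: (big_ind (homog d)); first exact: homog0.
  exact: homogD.
by move=> i _; apply: hF; rewrite subnKC // -ltnS.
Qed.

Notation shom := (@fps_homog K A k).

Lemma shomD d x y : shom d x -> shom d y -> shom d (x + y).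
Proof. by move=> hx hy n; apply: homogD; [exact: hx|exact: hy]. Qed.

Lemma shomN d x : shom d x -> shom d (- x).
Proof. by move=> hx n; apply: homogN; exact: hx. Qed.

Lemma shom0 d : shom d 0.
Proof. by move=> n; apply: homog0. Qed.

Lemma shom_smul d e x y : shom d x -> shom e y -> shom (d + e) (smul x y).
Proof.
move=> hx hy n; apply: homog_cauchy => i j <-.
by rewrite PoszD mulrDl opprD addrACA; apply: gmul_deg.
Qed.

Lemma shom_sone : shom 0 (sone A).
Proof. by case=> [|n]; [rewrite mul0r subr0; apply: gone_deg|apply: homog0]. Qed.

Lemma shom_tpow m d x : shom d x -> shom (d + m%:Z * (k + 1)) (tpow m x).
Proof.
move=> hx n; case: (ltnP n m) => nm; first by rewrite tpow_lt //; apply: homog0.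
rewrite -(subnKC nm) tpow_add PoszD mulrDl opprD addrA addrK.
exact: hx.
Qed.

(** Makes the values of a linear selection homogeneous of total degree d, t having
    degree k + 1, and leaves those alone that already are. *)
Definition sproj d x : S := fun n => gproj A (d - n%:Z * (k + 1)) (x n).
Fact sproj_linear d : linear (sproj d).
Proof. by move=> e x y; apply: funext => n; apply: linearP. Qed.
HB.instance Definition _ d := GRing.isLinear.Build K S S _ (sproj d) (sproj_linear d).

Lemma shom_sproj d x : shom d (sproj d x).
Proof. by move=> n; apply: gproj_homog. Qed.

Lemma sproj_id d x : shom d x -> sproj d x = x.
Proof. by move=> hx; apply: funext => n; apply: gproj_id. Qed.

Hypothesis k_odd : odd `|k|%N.

Lemma oddz_k1 : oddz (k + 1) = false.
Proof. by rewrite oddzD /oddz k_odd. Qed.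

Lemma shom_homog_par d x n : shom d x -> homog_par (oddz d) (x n).
Proof.
move=> hx; exists (d - n%:Z * (k + 1)); last exact: hx.
by rewrite -mulNr oddzD oddzM oddz_k1 andbF addbF.
Qed.

Lemma shom_series_par d x : shom d x -> series_par (oddz d) x.
Proof. by move=> hx n; apply: span_gen; apply: shom_homog_par hx. Qed.

Section Operator.
Variable Delta : nat -> {linear A -> A}.
Hypotheses (BV : commBVinfty k Delta) (degen : degeneration k Delta).

Notation hD := (fps_op Delta).

Fact fps_op_linear : linear hD.
Proof.
move=> e x y; apply: funext => n.
transitivity (e *: hD x n + hD y n) => //.
rewrite !fps_opE (raddf_cauchy ( *:%R e)) -cauchyD; apply: cauchy_ext => i j _.
exact: linearP.
Qed.
Definition fps_op_lin : {linear S -> S} := HB.pack (hD : S -> S)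
  (GRing.isLinear.Build K S S _ (hD : S -> S) fps_op_linear).

Lemma fps_op_sq x : hD (hD x) = 0.
Proof. by apply: funext => n; apply: bv_sq BV x n. Qed.

Lemma fps_op_sone : hD (sone A) = 0.
Proof.
apply: funext => n; rewrite fps_opE; apply: cauchy0 => i [|j] _ /=; last exact: linear0.
exact: bv_one BV i.
Qed.

Lemma fps_op_tpow m x : hD (tpow m x) = tpow m (hD x).
Proof.
elim: m => //= m IH; apply: funext => -[|n]; rewrite fps_opE /=.
  by rewrite cauchyn0 linear0.
by rewrite cauchySr /= linear0 addr0 -IH.
Qed.

Lemma Delta_deg i : has_degree (bv_deg k i) (Delta i).
Proof.
case: i => [|i]; last by have [] := bv_diff BV (ltn0Sn i).
by rewrite /bv_deg mul0r subr0; apply: bv_deg0 BV.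
Qed.

Lemma oddz_bv_deg i : oddz (bv_deg k i) = true.
Proof. by rewrite /bv_deg -mulNr oddzD oddzM oddz_k1 andbF. Qed.

Lemma fps_op_par : op_par true hD.
Proof.
move=> c x hx n; rewrite fps_opE; apply: par_part_cauchy => i j _.
elim: (hx j) => [|e a b [m <- hm] _ IH]; first by rewrite linear0; apply: span_zero.
rewrite linearP; apply: span_step => //.
by exists (m + bv_deg k i); [rewrite oddzD oddz_bv_deg addbC|exact: Delta_deg].
Qed.

Definition const a : S := fun n => if n is 0%N then a else 0.

(** The degeneration property gives a closed series that starts with a up to a
    boundary Delta_0 z; adding D of the constant series z makes it start with a. *)
Lemma closed_lift d a : homog d a -> Delta 0 a = 0 ->
  exists x, [/\ shom d x, hD x = 0 & x 0%N = a].
Proof.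
move=> ha Da; have [x [z [hx Dx hz aE]]] := degen ha Da.
exists (x + hD (const z)); split.
- apply: shomD => // n; rewrite fps_opE; apply: homog_cauchy => i [|j] ij; last first.
    by rewrite linear0; apply: homog0.
  have := @Delta_deg i (d - 1) z hz; rewrite /bv_deg addrA subrK.
  by move: ij; rewrite addn0 => ->.
- rewrite [LHS](linearD fps_op_lin) /= fps_op_sq addr0; apply: funext => n; exact: Dx.
by rewrite aE -[LHS]/(_ + _) fps_opE cauchyn0.
Qed.

(** The homology of A[[t]] has no t-torsion.  By induction on m: if D (t^m c) is
    divisible by t^(m+1), then c starts with a cycle, and subtracting a closed
    series with the same start makes c divisible by t. *)
Lemma torsion_free m d y : shom d y -> (forall r, (r < m)%N -> hD y r = 0) ->
  exists2 c, shom (d - m%:Z * (k + 1)) c & hD (tpow m c) = hD y.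
Proof.
move=> hy; elim: m => [|m IH] y0; first by exists y; rewrite ?mul0r ?subr0.
have [r rm|c hc Dc] := IH; first by apply: y0; apply: ltnW.
have [||x [hx Dx x0]] := @closed_lift (d - m%:Z * (k + 1)) (c 0%N).
- by have := hc 0%N; rewrite mul0r subr0.
- by have := y0 m (ltnSn m); rewrite -Dc fps_op_tpow -[m in _ m = _]addn0 tpow_add fps_opE cauchyn0.
exists (fun n => c n.+1 - x n.+1).
  move=> n; rewrite -addrA -opprD -mulrDl -PoszD addSn -addnS PoszD mulrDl opprD addrA.
  by apply: homogD; [exact: hc|apply: homogN; exact: hx].
rewrite tpowS.
have -> : tmul (fun n => c n.+1 - x n.+1) = c - x.
  by apply: funext => -[|n] //; rewrite -[RHS]/(c 0%N - x 0%N) x0 subrr.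
by rewrite fps_op_tpow [hD _](linearB fps_op_lin) /= Dx subr0 -fps_op_tpow.
Qed.

Lemma torsion_selection m d : exists f : {linear S -> S},
  (forall y, shom (d - m%:Z * (k + 1)) (f y)) /\
  forall y, shom d y -> (forall r, (r < m)%N -> hD y r = 0) ->
    hD (tpow m (f y)) = hD y.
Proof.
have [||f fP] := @linear_selection K S S (fun y c =>
  shom (d - m%:Z * (k + 1)) c /\ hD (tpow m c) = hD y).
- by split; [exact: shom0|rewrite linear0].
- move=> e y c y' c' [hc Dc] [hc' Dc']; split.
    by move=> n; apply: homogD; [apply: homogZ; exact: hc|exact: hc'].
  by rewrite linearP !fps_op_linear Dc Dc'.
exists (sproj (d - m%:Z * (k + 1)) \o f); split=> [y|y hy y0]; first exact: shom_sproj.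
have [c hc Dc] := torsion_free hy y0.
by have [hf Df] := fP _ _ (conj hc Dc); rewrite /= sproj_id.
Qed.

Lemma closed_selection d : exists s : {linear A -> S},
  (forall a, shom d (s a)) /\
  forall a, homog d a -> Delta 0 a = 0 -> hD (s a) = 0 /\ s a 0%N = a.
Proof.
have [||s sP] := @linear_selection K A S (fun a x => [/\ shom d x, hD x = 0 & x 0%N = a]).
- by split=> //; [exact: shom0|rewrite [LHS](linear0 fps_op_lin)].
- move=> e a x a' x' [hx Dx <-] [hx' Dx' <-]; split=> //.
    by move=> n; apply: homogD; [apply: homogZ; exact: hx|exact: hx'].
  by rewrite fps_op_linear Dx Dx' scaler0 addr0.
exists (sproj d \o s); split=> [a|a ha Da]; first exact: shom_sproj.
have [x xP] := closed_lift ha Da.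
by have [hs Ds s0] := sP _ _ xP; rewrite /= sproj_id.
Qed.

End Operator.
End Series.

(** * Exponentials and sums of brackets over set partitions *)

Section Exponential.
Variables (K : fieldType) (A : gradedComAlg K) (k : int).
Hypothesis k_odd : odd `|k|%N.
Variable Delta : nat -> {linear A -> A}.
Hypotheses (BV : commBVinfty k Delta) (degen : degeneration k Delta).
Variable V : gradedMod K.

Notation S := (nat -> A).
Notation shom := (@fps_homog K A k).
Notation hD := (fps_op Delta).
Notation lparV := (@lpar K V).
Notation kbrS := (kbracket (@smul K A) (sone A)).
Notation kbrA := (kbracket (@gmul K A) (gone A)).
Implicit Types (u w B C : word V) (P Q : seq (word V)) (g : word V -> S).

(** The degree in A[[t]] of the weighted value at w: each letter of degree i in
    a module shifted by k + 1 has degree i + (k + 1) before the shift. *)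
Definition tdeg w : int := wdeg w + (size w)%:Z * (k + 1).

(** Multilinear and graded symmetric on nonempty words; the value at the empty
    word is free, as exponentials take the value 1 there. *)
Definition gsym (N : lmodType K) (g : word V -> N) : Prop :=
  [/\ forall u w i c x y, g (u ++ (i, c *: x + y) :: w) =
        c *: g (u ++ (i, x) :: w) + g (u ++ (i, y) :: w),
      forall u w i x, g (u ++ (i, x) :: w) = g (u ++ (i, gproj V i x) :: w)
    & forall u w i j x y, g (u ++ [:: (i, x), (j, y) & w]) =
        (-1) ^ (i * j) *: g (u ++ [:: (j, y), (i, x) & w])].

Definition shift_homog g : Prop := forall w, shom (wdeg w + (k + 1)) (g w).

(** A block B is weighted by t^(|B|-1), so that the products over the partitions
    of w are t^|w| times those of f/t, as in the exponential of f/t. *)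
Definition weighted g B : S := tpow (size B).-1 (g B).

Arguments weighted : simpl never.

Definition wletter g B : bool * S := (oddz (wdeg B), weighted g B).

Definition expS g w : S := part_sum lparV w (fun P => sprod (map (wletter g) P)).

Definition brackS g w : S := part_sum lparV w (fun P => kbrS true hD (map (wletter g) P)).

Lemma part_sum_compat (N : lmodType K) (Th : seq (word V) -> N) :
  blockC lparV Th ->
  (forall P Q u w i c x y, Th (P ++ (u ++ (i, c *: x + y) :: w) :: Q) =
     c *: Th (P ++ (u ++ (i, x) :: w) :: Q) + Th (P ++ (u ++ (i, y) :: w) :: Q)) ->
  (forall P Q u w i x, Th (P ++ (u ++ (i, x) :: w) :: Q) =
     Th (P ++ (u ++ (i, gproj V i x) :: w) :: Q)) ->
  (forall P Q u w i j x y, Th (P ++ (u ++ [:: (i, x), (j, y) & w]) :: Q) =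
     (-1) ^ (i * j) *: Th (P ++ (u ++ [:: (j, y), (i, x) & w]) :: Q)) ->
  gsym (fun w => part_sum lparV w Th).
Proof.
move=> hB hl homog_par hs; split=> [u w i c x y|u w i x|u w i j x y].
- by apply: part_sum_lin => // P Q u' w'; apply: hl.
- rewrite (@part_sum_lin _ lparV K _ 0 (i, x) (i, gproj V i x) (i, gproj V i x)) //.
    by rewrite scale0r add0r.
  by move=> P Q u' w'; rewrite homog_par scale0r add0r.
rewrite signed_exprz oddzM; apply: (part_sum_swap (p := lparV)) => // P Q u' w' [a xa] [b xb].
by rewrite hs signed_exprz oddzM.
Qed.

Lemma sprod_cat (X Y : seq (bool * S)) :
  sprod (X ++ Y) = foldr (fun e z => smul e.2 z) (sprod Y) X.
Proof. exact: foldr_cat. Qed.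

Lemma weighted_gsym g : gsym g -> gsym (weighted g).
Proof.
move=> [gl gp gs].
have sE u w (a b : int * V) : size (u ++ a :: w) = size (u ++ b :: w) by rewrite !size_cat.
split=> [u w i c x y|u w i x|u w i j x y]; rewrite /weighted.
- by rewrite gl linearP /= !(sE u w (i, c *: x + y) (i, x)) (sE u w (i, y) (i, x)).
- by rewrite -gp (sE u w (i, gproj V i x) (i, x)).
by rewrite gs linearZ /= !size_cat.
Qed.

Lemma foldr_smul_linear (X : seq (bool * S)) :
  linear (fun y : S => foldr (fun e z => smul e.2 z) y X).
Proof. by elim: X => //= e X IH c x y; rewrite IH linearP. Qed.

Lemma foldr_smulZ (X : seq (bool * S)) c (y : S) :
  foldr (fun e z => smul e.2 z) (c *: y) X = c *: foldr (fun e z => smul e.2 z) y X.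
Proof. by elim: X => //= e X ->; rewrite linearZ. Qed.

Lemma foldr_smul_signed (X : seq (bool * S)) b (y : S) :
  foldr (fun e z => smul e.2 z) (signed b y) X = signed b (foldr (fun e z => smul e.2 z) y X).
Proof. by elim: X => //= e X ->; rewrite (raddf_signed (smul e.2)). Qed.

Lemma wletter_par g C : shift_homog g ->
  series_par (wletter g C).1 (wletter g C).2.
Proof.
move=> hg; have := shom_series_par k_odd (shom_tpow (size C).-1 (hg C)).
by rewrite oddzD oddzM (oddz_k1 k_odd) andbF addbF oddzD (oddz_k1 k_odd) addbF.
Qed.

Lemma expS_gsym g : gsym g -> shift_homog g -> gsym (expS g).
Proof.
move=> /weighted_gsym [wl wpr ws] hg; apply: part_sum_compat.
- move=> P Q B C; rewrite !map_cat !sprod_cat /=.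
  rewrite (smulCA _ (wletter_par B hg) (wletter_par C hg)) !wpar_lpar.
  by rewrite foldr_smul_signed.
- move=> P Q u w i c x y; rewrite !map_cat !sprod_cat /= wl.
  by rewrite -[smul (_ + _) _]/(smull _ _) linearP foldr_smul_linear.
- by move=> P Q u w i x; rewrite !map_cat !sprod_cat /= wpr.
move=> P Q u w i j x y; rewrite !map_cat !sprod_cat /= ws /=.
by rewrite -[smul (_ *: _) _]/(smull _ _) linearZ foldr_smulZ.
Qed.

Lemma tdeg_flatten P w : Permutation (flatten P) w -> \sum_(C <- P) tdeg C = tdeg w.
Proof.
move=> Pw; have -> : tdeg w = tdeg (flatten P).
  elim: Pw => // [a u u' _|a b u|u u' u'' _ -> _ -> //].
    by rewrite /tdeg !wdeg_cons /= !intS !mulrDl -!addrA => IH;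
    congr (_ + _); rewrite addrCA IH [RHS]addrCA.
  by rewrite /tdeg !wdeg_cons addrCA.
elim: P {Pw} => [|B P IH] /=; first by rewrite big_nil /tdeg wdeg_nil mul0r.
by rewrite big_cons IH /tdeg wdeg_cat size_cat PoszD mulrDl addrACA.
Qed.

Lemma expS_homog g w : shift_homog g -> shom (tdeg w) (expS g w).
Proof.
move=> hg; apply: part_sum_closed; [exact: shom0|exact: shomD|exact: shomN|].
move=> P /tdeg_flatten <-; elim: P => [|C P IH] /=; first by rewrite big_nil => _; apply: shom_sone.
move=> /andP[sC /IH hP]; rewrite big_cons; apply: shom_smul => //.
have -> : tdeg C = wdeg C + (k + 1) + (size C).-1%:Z * (k + 1).
  by rewrite /tdeg -{1}(prednK sC) intS mulrDl mul1r addrA.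
by apply: shom_tpow; apply: hg.
Qed.

Lemma wletter_good g P : shift_homog g ->
  List.Forall (fun e : bool * S => series_par e.1 e.2) (map (wletter g) P).
Proof. by move=> hg; elim: P => //= C P IH; constructor => //; apply: wletter_par. Qed.

(** The identity apply_sprod summed over all partitions of w. *)
Lemma fps_op_exp g w : shift_homog g ->
  hD (expS g w) = unsh_sum lparV w (fun l r => smul (brackS g l) (expS g r)).
Proof.
move=> hg; rewrite -[LHS]/(fps_op_lin Delta (expS g w)) raddf_part_sum.
transitivity (part_sum lparV w (fun P => unsh_sum (wpar lparV) P (fun L R =>
    smul (kbrS true hD (map (wletter g) L)) (sprod (map (wletter g) R))))).
  congr (part_sum _ _ _); apply: funext => P.
  rewrite -[LHS]/(hD _) (apply_sprod (wletter_good P hg) (fps_op_par k_odd BV)) unsh_sum_map.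
  have -> // : fst \o wletter g = wpar lparV.
  by apply: funext => B; rewrite /= wpar_lpar.
rewrite part_sum_unsh; congr (unsh_sum _ _ _); apply: funext => l; apply: funext => r.
rewrite -[RHS]/(smull _ _) /brackS raddf_part_sum; congr (part_sum _ _ _); apply: funext => L.
by rewrite -[RHS]/(smul _ (expS g r)) /expS raddf_part_sum.
Qed.

Lemma expS_nil g : expS g [::] = sone A.
Proof. by []. Qed.


(** The commutator of the derivation Delta_0 with x is the multiplication by
    Delta_0 x, which commutes with the multiplication by y. *)
Lemma kbracket_derivation s : List.Forall (fun e : bool * A => homog_par e.1 e.2) s ->
  (1 < size s)%N -> kbrA true (Delta 0) s = 0.
Proof.
case: s => [|[b x] [|[c y] s]] // hs _.
have [hx hy] : homog_par b x /\ homog_par c y.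
  by split; [exact: List.Forall_inv hs|exact: List.Forall_inv (List.Forall_inv_tail hs)].
have [i ib hi] := hx.
have br1 z : Delta 0 (gmul x z) - signed b (gmul x (Delta 0 z)) = gmul (Delta 0 x) z.
  by rewrite (bv_leibniz BV _ hi) signed_exprz ib addrK.
have hDx : par_part (true (+) b) (Delta 0 x).
  apply: span_gen; exists (i + 1); last exact: bv_deg0 BV i x hi.
  by rewrite oddzD ib addbC.
have hy' : par_part c y by apply: span_gen.
rewrite -[LHS]/(kbrA (true (+) b (+) c) (fun z =>
  (Delta 0 (gmul x (gmul y z)) - signed b (gmul x (Delta 0 (gmul y z)))) -
  signed ((true (+) b) && c) (gmul y (Delta 0 (gmul x z) - signed b (gmul x (Delta 0 z))))) s).
rewrite -[RHS](@kbracket0 K A (true (+) b (+) c) s); congr (kbracket _ _ _ _ _).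
apply: funext => z; rewrite !br1 !gmulA (par_part_comm hDx hy').
by rewrite -[gmul (signed _ _) _]/(gmulr _ _) raddf_signed subrr.
Qed.

Lemma kbracket_Delta_vanish i s : List.Forall (fun e : bool * A => homog_par e.1 e.2) s ->
  (i.+1 < size s)%N -> kbrA true (Delta i) s = 0.
Proof.
case: i => [|i]; first exact: kbracket_derivation.
move=> hs ss; have [_ ord] := bv_diff BV (ltn0Sn i).
have [t [ht tE]] : exists t : word A, all_homog t /\ [seq (oddz c.1, c.2) | c <- t] = s.
  elim: hs {ss} => [|[b x] s' [j jb hj] _ [t [ht <-]]]; first by exists [::].
  by exists ((j, x) :: t); rewrite /= jb hj.
rewrite -tE in ss *; rewrite size_map in ss.
by rewrite -(oddz_bv_deg k_odd i.+1) -koszul_kbracket ord.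
Qed.

Definition brack0 (f : word V -> A) w : A := part_sum lparV w (fun P =>
  kbrA true (Delta (size P).-1) [seq (oddz (wdeg C), f C) | C <- P]).

(** The power of t at which the bracket of the weighted blocks starts: their
    weights contribute sum (|B|-1), the bracket one less than the number of
    blocks, and the total depends on the length of the word only. *)
Lemma sizes_flatten P : all (fun B => (0 < size B)%N) P ->
  (size (flatten P)).-1 = ((size P).-1 + \sum_(C <- P) (size C).-1)%N.
Proof.
case: P => [|B P] /=; first by rewrite big_nil.
move=> /andP[sB sP]; rewrite big_cons size_cat.
have -> : size (flatten P) = (size P + \sum_(C <- P) (size C).-1)%N.
  elim: P sP => [|C P IH] /=; first by rewrite big_nil.
  move=> /andP[sC /IH sP]; rewrite big_cons size_cat sP -{1}(prednK sC) !addSn.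
  by congr _.+1; rewrite addnCA.
by rewrite -{1}(prednK sB) addSn /= addnCA.
Qed.

Lemma brackS_lead g w r : shift_homog g -> (0 < size w)%N -> (r <= (size w).-1)%N ->
  brackS g w r = if r == (size w).-1 then brack0 (fun C => g C 0%N) w else 0.
Proof.
move=> hg sw rw; rewrite -[LHS]/(coef r _) raddf_part_sum.
transitivity (part_sum lparV w (fun P => if r == (size w).-1 then
    kbrA true (Delta (size P).-1) [seq (oddz (wdeg C), g C 0%N) | C <- P] else 0)); last first.
  by case: (r == _) => //; apply: part_sum0.
apply: part_sum_ext => P Pw nP; rewrite -[LHS]/(kbrS _ _ _ r).
have sE : (size w).-1 = ((size P).-1 + \sum_(C <- P) (size C).-1)%N.
  by rewrite -sizes_flatten //; congr _.-1; apply/esym/(Permutation_length Pw).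
pose X := [seq (oddz (wdeg C), ((size C).-1, weighted g C)) | C <- P].
have XE : \sum_(e <- X) e.2.1 = \sum_(C <- P) (size C).-1 by rewrite big_map.
have := @kbracket_lead K A true (fun i => Delta i) (size P).-1 X.
rewrite XE -sE -!map_comp => -> //.
- case: eqP => // _; congr (kbracket _ _ _ _ _); apply: eq_map => C /=.
  by rewrite /weighted -[X in tpow _ _ X]addn0 tpow_add.
- by move=> i u v; rewrite linearD.
- rewrite /X; elim: (P) => //= C Q IH; constructor=> //=; split=> j.
    by move=> jC; rewrite /weighted tpow_lt.
  have := shom_homog_par k_odd j (shom_tpow (size C).-1 (hg C)).
  by rewrite oddzD oddzM (oddz_k1 k_odd) andbF addbF oddzD (oddz_k1 k_odd) addbF.
move=> i s iP hs ss; apply: kbracket_Delta_vanish => //.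
by rewrite ss size_map; move: iP; case: (size P).
Qed.

End Exponential.

(** * A family of series whose exponential is closed *)

Section Logarithm.
Variables (K : fieldType) (A : gradedComAlg K) (k : int).
Hypothesis k_odd : odd `|k|%N.
Variable Delta : nat -> {linear A -> A}.
Hypotheses (BV : commBVinfty k Delta) (degen : degeneration k Delta).
Variables (V : gradedMod K) (s1 : int -> V -> nat -> A).

Notation S := (nat -> A).
Notation shom := (@fps_homog K A k).
Notation hD := (fps_op Delta).
Notation lparV := (@lpar K V).
Implicit Types (u w B C : word V) (P Q : seq (word V)) (g : word V -> S).

Hypotheses (s1_lin : forall i, linear (s1 i))
  (s1_proj : forall i x, s1 i (gproj V i x) = s1 i x)
  (s1_hom : forall i x, shom (i + (k + 1)) (s1 i x))
  (s1_closed : forall i x, hD (s1 i x) = 0).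

(** A linear choice of c with D (t^m c) = D y, for y of degree d with D y
    divisible by t^m. *)
Definition correction m d : {linear S -> S} := projT1 (cid (torsion_selection BV degen m d)).

Lemma correction_homog m d y : shom (d - m%:Z * (k + 1)) (correction m d y).
Proof. exact: (proj1 (projT2 (cid (torsion_selection BV degen m d))) y). Qed.

Lemma correctionP m d y : shom d y -> (forall r, (r < m)%N -> hD y r = 0) ->
  hD (tpow m (correction m d y)) = hD y.
Proof. exact: (proj2 (projT2 (cid (torsion_selection BV degen m d))) y). Qed.

Definition linear_term w : S := if w is [:: a] then s1 a.1 a.2 else 0.

(** The family restricted to words of length at most n, and zero on longer ones,
    so that the exponential of approx m at a word of length m + 1 is the sum over
    its partitions into at least two blocks. *)
Fixpoint approx n w : S :=
  if n is m.+1 then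
    if (size w <= m)%N then approx m w
    else if size w == m.+1 then
      if m is 0%N then linear_term w else - correction m (tdeg k w) (expS (approx m) w)
    else 0
  else 0.

Definition taylorS w : S := approx (size w) w.

Lemma approx_stable n w : approx n w = if (size w <= n)%N then taylorS w else 0.
Proof.
elim: n => [|n IH]; first by case: w.
case: (ltngtP (size w) n.+1) => [lt|gt|eq].
- by rewrite /= -ltnS lt IH -ltnS lt.
- by rewrite /= -ltnS ltnNge (ltnW gt) /= gtn_eqF.
by rewrite /taylorS eq.
Qed.

Lemma linear_term_gsym : gsym linear_term.
Proof.
split=> [[|a [|b u]] [|e w] i c x y|[|a [|b u]] [|e w] i x|[|a [|b u]] w i j x y] //=;
  by rewrite ?scaler0 ?addr0 ?s1_lin ?s1_proj.
Qed.

Lemma linear_term_homog : shift_homog k linear_term.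
Proof.
case=> [|[i x] [|b w]] /=; try exact: shom0.
by rewrite /wdeg big_seq1; apply: s1_hom.
Qed.

Lemma approx_homog n : shift_homog k (approx n).
Proof.
elim: n => [|n IH] w /=; first exact: shom0.
case: (size w <= n)%N => //; case: eqP => [sw|_]; last exact: shom0.
case: n IH sw => [|n] IH sw; first exact: linear_term_homog.
apply: shomN; have -> : wdeg w + (k + 1) = tdeg k w - n.+1%:Z * (k + 1).
  by rewrite /tdeg sw [n.+2%:Z]intS (mulrDl 1) mul1r [in RHS]addrA addrK.
exact: correction_homog.
Qed.

Lemma tdegE u w : wdeg u = wdeg w -> size u = size w -> tdeg k u = tdeg k w.
Proof. by rewrite /tdeg => -> ->. Qed.

Lemma approx_gsym n : gsym (approx n).
Proof.
elim: n => [|n IH].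
  by split=> *; rewrite /= ?scaler0 ?addr0.
have [al ap as_] := IH; have [sl sp ss] := linear_term_gsym.
have [el ep es] := expS_gsym k_odd IH (@approx_homog n).
split=> [u w i c x y|u w i x|u w i j x y] /=; rewrite !size_cat /=.
- case: ifP => _; first exact: al.
  case: ifP => _; last by rewrite scaler0 addr0.
  case: (n) el => [|m] el; first exact: sl.
  have tE z : tdeg k (u ++ (i, z) :: w) = tdeg k (u ++ (i, x) :: w).
    by apply: tdegE; rewrite ?size_cat // !wdeg_cat !wdeg_cons.
  by rewrite !tE el linearP scalerN opprD.
- case: ifP => _; first exact: ap.
  case: ifP => _ //; case: (n) ep => [|m] ep; first exact: sp.
  rewrite -ep; congr (- correction _ _ _).
  by apply: tdegE; rewrite ?size_cat // !wdeg_cat !wdeg_cons.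
case: ifP => _; first exact: as_.
case: ifP => _; last by rewrite scaler0.
case: (n) es => [|m] es; first exact: ss.
rewrite es linearZ scalerN; congr (- (_ *: correction _ _ _)).
by apply: tdegE; rewrite ?size_cat // !wdeg_cat !wdeg_cons; congr (_ + _); rewrite addrCA.
Qed.

Lemma taylorS_homog : shift_homog k taylorS.
Proof. by move=> w; apply: approx_homog. Qed.

Lemma taylorS_gsym : gsym taylorS.
Proof.
have E N w : (size w <= N)%N -> taylorS w = approx N w by rewrite approx_stable => ->.
split=> [u w i c x y|u w i x|u w i j x y].
- have [al _ _] := approx_gsym (size (u ++ (i, x) :: w)).
  by rewrite !(E (size (u ++ (i, x) :: w))) ?al // !size_cat.
- have [_ ap _] := approx_gsym (size (u ++ (i, x) :: w)).
  by rewrite !(E (size (u ++ (i, x) :: w))) -?ap // !size_cat.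
have [_ _ as_] := approx_gsym (size (u ++ [:: (i, x), (j, y) & w])).
by rewrite !(E (size (u ++ [:: (i, x), (j, y) & w]))) -?as_ // !size_cat.
Qed.

Lemma wletter_ext g g' B : g B = g' B -> wletter g B = wletter g' B.
Proof. by rewrite /wletter /weighted => ->. Qed.

Lemma map_wletter_ext g g' P n : (forall B, (size B <= n)%N -> g B = g' B) ->
  all (fun B => (size B <= n)%N) P -> map (wletter g) P = map (wletter g') P.
Proof.
move=> gg; elim: P => //= B P IH /andP[sB /IH ->].
by rewrite (wletter_ext (gg B sB)).
Qed.

Lemma blocks_le P w : Permutation (flatten P) w -> all (fun B => (size B <= size w)%N) P.
Proof.
move=> /Permutation_length Pw; have <- : size (flatten P) = size w by exact: Pw.
elim: P {Pw} => //= B P IH; rewrite size_cat leq_addr /=.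
by apply: sub_all IH => C /leq_trans -> //; apply: leq_addl.
Qed.

Lemma brackS_ext g g' w : (forall B, (size B <= size w)%N -> g B = g' B) ->
  brackS Delta g w = brackS Delta g' w.
Proof.
move=> gg; apply: part_sum_ext => P /blocks_le Pw _.
by rewrite (map_wletter_ext gg Pw).
Qed.

Lemma blocks_lt P w : Permutation (flatten P) w -> all (fun B => (0 < size B)%N) P ->
  (1 < size P)%N -> all (fun B => (size B < size w)%N) P.
Proof.
move=> Pw; have <- : size (flatten P) = size w by exact: (Permutation_length Pw).
case: P {Pw} => [|B [|C P]] //; set Q := C :: P => /= /andP[sB sQ] _.
have Q0 : (0 < size (flatten Q))%N.
  by move: sQ => /= /andP[sC _]; rewrite size_cat addn_gt0 sC.
rewrite size_cat -[X in (X < _)%N]addn0 ltn_add2l Q0 /=.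
apply: sub_all (blocks_le (Permutation_refl (flatten Q))) => D /leq_ltn_trans -> //.
by rewrite -[X in (X < _)%N]add0n ltn_add2r.
Qed.

(** The one-block partition is the only one that sees the value at w itself. *)
Lemma expS_split m w : size w = m.+1 ->
  expS taylorS w = expS (approx m) w + tpow m (taylorS w).
Proof.
move=> sw; have -> : tpow m (taylorS w) = part_sum lparV w (fun P =>
    if P is [:: B] then weighted taylorS B else 0).
  by rewrite part_sum_one /weighted sw; case: (w) sw.
rewrite -part_sumD; apply: part_sum_ext => -[|B [|C P]] Pw nP.
- have : size (flatten ([::] : seq (word V))) = size w by exact: (Permutation_length Pw).
  by rewrite sw.
- have sB : size B = m.+1.
    by rewrite -sw -[B]cats0; apply: (Permutation_length Pw).
  rewrite /= !smul1 /weighted approx_stable sB ltnn.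
  by rewrite linear0 add0r.
rewrite addr0; congr sprod; apply: (@map_wletter_ext _ _ _ m) => [D sD|].
  by rewrite approx_stable sD.
by apply: sub_all (blocks_lt Pw nP _) => // D; rewrite sw.
Qed.

Lemma taylorS1 i x : taylorS [:: (i, x)] = s1 i x.
Proof. by []. Qed.

(** By induction phi vanishes on shorter words, so D e(w) = phi(w), and it is
    enough that e(w) is closed.  Without the one-block partition D e(w) is
    divisible by t^m where m + 1 = |w|, and t^m taylorS(w) was chosen to cancel
    it. *)
Lemma brackS_taylorS w : brackS Delta taylorS w = 0.
Proof.
have [n] := ubnP (size w); elim: n w => // n IH w; rewrite ltnS => wn.
have top g : shift_homog k g -> (forall l, (size l < size w)%N -> brackS Delta g l = 0) ->
    hD (expS g w) = brackS Delta g w.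
  move=> hg gl; rewrite (fps_op_exp k_odd BV w hg) unsh_sum_top ?smul1 // => l r lw.
  by rewrite gl // -[LHS]/(smull _ _) linear0.
rewrite -top; [|exact: taylorS_homog|by move=> l lw; apply: IH; apply: leq_trans wn].
case sw : (size w) => [|m].
  by case: (w) sw => // _; rewrite expS_nil (fps_op_sone BV).
rewrite (expS_split sw) [LHS](linearD (fps_op_lin Delta)) /=.
case: m sw => [|m] sw.
  case: w sw {wn top} => [|[i x] [|b w]] // _.
  rewrite /= taylorS1 s1_closed addr0.
  have -> : expS (fun=> 0 : S) [:: (i, x)] = 0.
    apply: part_sum0 => -[|B P] Pw _; first by have := Permutation_nil Pw.
    by rewrite /= /weighted linear0 -[LHS]/(smull _ _) linear0.
  by rewrite [LHS](linear0 (fps_op_lin Delta)).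
have low : hD (expS (approx m.+1) w) = brackS Delta (approx m.+1) w.
  apply: top => [|l]; first exact: approx_homog.
  rewrite sw ltnS => lm; rewrite (@brackS_ext _ taylorS).
    by apply: IH; apply: leq_trans wn; rewrite sw ltnS.
  by move=> B Bl; rewrite approx_stable (leq_trans Bl lm).
have -> : taylorS w = - correction m.+1 (tdeg k w) (expS (approx m.+1) w).
  by rewrite /taylorS sw /= sw ltnn eqxx.
have tN c : hD (tpow m.+1 (- c)) = - hD (tpow m.+1 c).
  by rewrite linearN; exact: (linearN (fps_op_lin Delta)).
rewrite tN correctionP ?subrr //.
  exact: expS_homog (@approx_homog _).
move=> r rm; rewrite low (brackS_lead k_odd BV (@approx_homog _)) ?sw //=; last exact: ltnW.
by rewrite (ltn_eqF rm).
Qed.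

Lemma brack0_taylorS w : (0 < size w)%N -> brack0 Delta (fun C => taylorS C 0%N) w = 0.
Proof.
move=> sw; have := brackS_lead k_odd BV taylorS_homog sw (leqnn _).
by rewrite eqxx brackS_taylorS => <-.
Qed.

End Logarithm.

(** * The weak equivalence *)

Section ZeroStructure.
Variables (K : fieldType) (V : gradedMod K).

Lemma tens_ext (X Y M : lmodType K) (f g : {linear tens X Y -> M}) :
  (forall x y, f (tensor x y) = g (tensor x y)) -> f =1 g.
Proof.
move=> fg; apply: pres_ind => [|c [x y] u IH]; first by rewrite !linear0.
by rewrite !linearP IH; congr (_ *: _ + _); exact: fg.
Qed.

Fact zero_deg d (u : Sbar V) : Sbar_deg d u -> Sbar_deg (d + 1) (\0 u : Sbar V).
Proof. by move=> _; apply: span_zero. Qed.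

Fact zero_coder (u : Sbar V) : coprod (\0 u : Sbar V) =
  tmap (\0 : Sbar V -> Sbar V) id (coprod u) +
    tmap (@parity K V) (\0 : Sbar V -> Sbar V) (coprod u).
Proof.
have -> : tmap (\0 : Sbar V -> Sbar V) id (coprod u) = 0.
  apply: (tens_ext (f := tmap (\0 : {linear Sbar V -> Sbar V}) idfun) (g := \0)) => x y.
  exact: etrans (tmapE (\0 : {linear Sbar V -> Sbar V}) idfun x y) (tensor0l _ _).
have -> : tmap (@parity K V) (\0 : Sbar V -> Sbar V) (coprod u) = 0.
  apply: (tens_ext (f := tmap (@parity K V) (\0 : {linear Sbar V -> Sbar V})) (g := \0)) => x y.
  exact: etrans (tmapE (@parity K V) (\0 : {linear Sbar V -> Sbar V}) x y) (tensor0r _ _).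
by rewrite addr0 -[\0 u]/(0 : Sbar V) linear0.
Qed.

Definition zero_Linfty : Linfty V :=
  @MkLinfty K V (\0 : {linear Sbar V -> Sbar V}) zero_deg zero_coder (fun=> erefl).

End ZeroStructure.

Section Extension.
Variables (K : fieldType) (charK : [pchar K] =i pred0) (V W : gradedMod K).
Variables (Q : Linfty W) (f : word V -> W).
Hypothesis f_compat : gsym f.

(** For the zero structure on V, an L_oo[1] morphism is a coalgebra morphism F
    with Q F = 0, and Q F is a coderivation along F. *)
Lemma linfty_from_zero :
  (forall w, (0 < size w)%N -> part_sum (@lpar K V) w (fun P => taylor Q (blocks f P)) = 0) ->
  exists F : Linfty_morph (zero_Linfty V) Q,
    forall w, corestr (F (wd w)) = corestr (coalg_word f w).
Proof.
have [fl fp fs] := f_compat; move=> f0.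
pose F := coalg_mor fl fp fs.
have FE w : F (wd w) = coalg_word f w by exact: coalg_mor_wd.
have QF0 : forall x, Q (F x) = 0.
  apply: (coder_along_zero charK (D := Q \o F)) => w; last first.
    rewrite -[LHS]/(corestr (Q (F (wd w)))) FE /coalg_word.
    rewrite (raddf_part_sum _ Q) (raddf_part_sum _ (@corestr K W)).
    case: w => [|a w]; last exact: f0.
    by rewrite /= wd_nil !linear0.
  move=> IH; rewrite -[LHS]/(coprod (Q (F (wd w)))) Lcod_coder coalg_mor_coprod coprodE.
  rewrite (raddf_unsh_sum _ (tmap F F)) (raddf_unsh_sum _ (tmap Q idfun)).
  rewrite (raddf_unsh_sum _ (tmap (@parity K W) Q)) -unsh_sumD -[RHS](unsh_sum0 (@lpar K V) _ w).
  have QF l r : Permutation (l ++ r) w -> r = [::] \/ Q (F (wd l)) = 0.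
    move=> /Permutation_length lr; have {}lr : size (l ++ r) = size w := lr.
    case: r lr => [|b r] lr; [by left|right; apply: IH].
    by rewrite -lr size_cat -[X in (X < _)%N]addn0 ltn_add2l.
  have QF' l r : Permutation (l ++ r) w -> l = [::] \/ Q (F (wd r)) = 0.
    move=> /Permutation_length lr; have {}lr : size (l ++ r) = size w := lr.
    case: l lr => [|b l] lr; [by left|right; apply: IH].
    by rewrite -lr size_cat -[X in (X < _)%N]add0n ltn_add2r.
  apply: unsh_sum_ext => l r lr.
  have h1 : tmap Q idfun (tmap F F (tensor (wd l) (wd r))) = 0.
    rewrite tmapE [LHS]tmapE; case: (QF _ _ lr) => [->|->]; last exact: tensor0l.
    by rewrite wd_nil linear0 tensor0r.
  have h2 : tmap (@parity K W) Q (tmap F F (tensor (wd l) (wd r))) = 0.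
    rewrite !tmapE; case: (QF' _ _ lr) => [->|->]; last exact: tensor0r.
    by rewrite wd_nil !linear0 tensor0l.
  by rewrite -[RHS]addr0; congr (_ + _).
exists (@MkMorph K V W (zero_Linfty V) Q F (coalg_mor_deg fl fp fs) (coalg_mor_coprod fl fp fs)
  (fun u => etrans (linear0 F) (esym (QF0 u)))) => w.
by rewrite /= -FE.
Qed.
End Extension.

Theorem theorem6p16 (K : fieldType) (charK : [pchar K] =i pred0)
    (k : int) (k_odd : odd `|k|%N)
    (A : gradedComAlg K) (Delta : nat -> {linear A -> A})
    (BV : commBVinfty k Delta) (degen : degeneration k Delta)
    (Q : Linfty (shift A (k + 1))) (QE : is_bv_Linfty Delta Q) :
  homotopy_abelian (MkLinftyAlg Q).
Proof.
have D_deg i (x : A) : homog i x -> homog (i + 1) (Delta 0 x) by apply: bv_deg0 BV i x.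
have [p [h [[p_deg h_deg Dp pD pp] pDh]]] := homology_projector D_deg (bv_sq0 BV).
(* V is H[k+1], and inc the inclusion of H into A. *)
pose V := shift (fixed_gmod p_deg) (k + 1).
pose inc (x : V) : A := val (x : fixed_type p).
have inc_p x : p (inc x) = inc x by apply/eqP; exact: (valP (x : fixed_type p)).
have inc_lin : linear inc by [].
have inc_homog i x : homog i x = homog (i + (k + 1)) (inc x).
  by rewrite /homog -(inj_eq val_inj).
pose s d := projT1 (cid (closed_selection BV degen d)).
have sP d := projT2 (cid (closed_selection BV degen d)).
(* s1 lifts the elements of H to closed series with the same constant term. *)
pose s1 i (x : V) := s (i + (k + 1)) (inc (gproj V i x)).
have s1_hom i x : fps_homog k (i + (k + 1)) (s1 i x) by exact: (proj1 (sP _)).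
have [s1_closed s1_0] : (forall i x, fps_op Delta (s1 i x) = 0) /\
    (forall i x, s1 i x 0%N = inc (gproj V i x)).
  have all2 i x : fps_op Delta (s1 i x) = 0 /\ s1 i x 0%N = inc (gproj V i x).
    apply: (proj2 (sP _)); first by rewrite -inc_homog; apply: gproj_homog.
    by rewrite -inc_p Dp.
  by split=> i x; have [] := all2 i x.
have s1_lin i : linear (s1 i).
  by move=> c x y; rewrite /s1 linearP inc_lin linearP.
have s1_proj i x : s1 i (gproj V i x) = s1 i x by rewrite /s1 gprojE eqxx.
pose f w : shift A (k + 1) := taylorS BV degen s1 w 0%N.
have f_compat : gsym f.
  have [fl fp fs] := taylorS_gsym k_odd BV degen s1_lin s1_proj s1_hom.
  split=> [u w i c x y|u w i x|u w i j x y].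
  - by rewrite /f fl.
  - by rewrite /f fp.
  by rewrite /f fs.
have f_homog w : homog (wdeg w) (f w).
  have := taylorS_homog BV degen s1_hom w 0%N.
  by rewrite mul0r subr0.
have f_cycle w : (0 < size w)%N ->
    part_sum (@lpar K V) w (fun P => taylor Q (blocks f P)) = 0.
  move=> sw; rewrite -[RHS](brack0_taylorS k_odd BV degen s1_hom s1_closed sw).
  apply: part_sum_ext => P Pw nP.
  rewrite QE; last by elim: (P) => //= B R ->; rewrite f_homog.
  have : (0 < size P)%N.
    by case: (P) Pw => // /Permutation_nil w0; move: sw; rewrite w0.
  have lE R : [seq (oddz (wdeg C), f C : A) | C <- R] =
      [seq (oddz a.1, a.2 : A) | a <- [seq (a.1 + (k + 1), a.2 : A) | a <- blocks f R]].
    rewrite -!map_comp; apply: eq_map => C /=.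
    by rewrite oddzD (oddz_k1 k_odd) addbF.
  case: P {Pw nP} => [|B [|C P]] // _.
    by rewrite /= (bv_one BV) gmulr1 raddf0 signed0 subr0.
  rewrite -[RHS]/(kbracket _ _ true _ [seq (oddz (wdeg C), f C : A) | C <- B :: C :: P]).
  by rewrite lE -(oddz_bv_deg k_odd (size P).+1) -koszul_kbracket /= size_map.
have [F FE] := linfty_from_zero charK f_compat f_cycle.
have F1 i x : linear_part F i x = inc (gproj V i x).
  rewrite /linear_part FE /coalg_word part_sum1 corestr_wd /= -s1_0.
  exact: (eqP (f_homog [:: (i, x)])).
have Q1 i (x : shift A (k + 1)) : homog i x -> Ldiff Q i x = Delta 0 x.
  by move=> hx; rewrite /Ldiff QE //= hx.
exists (MkLinftyAlg (zero_Linfty V)).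
  by move=> w _; rewrite /taylor /= linear0.
apply: rst_sym; apply: rst_step; exists F; split=> [i x z hx _ hz|i y hy].
  rewrite F1 (Q1 _ _ hz) (gproj_id hx) => xE; exists 0; first by rewrite /homog linear0.
  rewrite /Ldiff /taylor /= linear0; apply: val_inj; rewrite linear0.
  by rewrite -[LHS]/(inc x) -inc_p xE pD.
rewrite Q1 // => Dy.
have py_fix : p y \in fixed p by apply/eqP; exact: pp.
pose x : V := (Sub (p y) py_fix : fixed_type p).
have xE : inc x = p y by [].
have hx : homog i x by rewrite inc_homog xE; exact (p_deg _ _ hy).
have hz : homog (i - 1) (h y : shift A (k + 1)).
  by have := h_deg _ _ hy; rewrite addrAC.
exists x, (h y); split=> //; first by rewrite /Ldiff /taylor /= linear0.
by rewrite F1 (gproj_id hx) xE Q1 //; exact: pDh.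
Qed.
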